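(* Consider the compressed gradient tracking iteration (C-GT) described in the context, for a network of $n$ agents with nonnegative doubly stochastic weight matrix $\mathbf{W}$ of a (strongly) connected graph, local cost functions $f_i$ that are $\mu_i$-strongly convex with $L_i$-Lipschitz gradients, and a compression operator $\mathcal{C}$ satisfying the general compression assumption with constants $C\ge 0$, $\delta\in(0,1]$, $r>0$. Suppose $\bar\eta\ge M\hat\eta$ for some $M>0$, $\alpha_x=\alpha_y=1/r$, the consensus step-size $\gamma>0$ satisfies $$\gamma\le\min\Big\{1,\frac{\delta}{m(2-\delta)}\Big\},$$ and the maximum step-size $\hat\eta>0$ satisfies $$\hat\eta\le\frac{s^2}{\sqrt{12\left[\left(\frac{24\kappa^2}{M^2}+1\right)(4s^2+36\lambda)+2s^2\right]}}\,\frac{\gamma}{L},$$ where $\kappa=L/\mu$, $s=1-\rho_w$, $\lambda=\|\mathbf{I}-\mathbf{W}\|^2$ and $$m=\frac{6}{\delta}\Big[\Big(\frac{72\kappa^2}{M^2}+\lambda+3\Big)\Big(\frac{432C\lambda^2}{s^4}+\frac{48C\lambda}{s^2}\Big)+(3\lambda+6)\frac{12C\lambda}{s^2}+4C\lambda\Big]+\frac{M}{2\kappa}.$$ Then the optimization error $\Omega_o^k=\mathbb{E}\big[\|\overline{\mathbf{X}}^k-\mathbf{x}^*\|^2\big]$ and the consensus error $\Omega_c^k=\mathbb{E}\big[\|\mathbf{X}^k-\mathbf{1}\overline{\mathbf{X}}^k\|^2\big]$ both converge to $0$ at the linear rate $\mathcal{O}\big((1-\tfrac12 M\hat\eta\mu)^k\big)$,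 i.e. both are bounded by a constant independent of $k$ times $(1-\tfrac12 M\hat\eta\mu)^k$ for all $k\ge0$.
   Context: Problem: minimize $f(x)=\frac1n\sum_{i=1}^n f_i(x)$ over $x\in\mathbb{R}^p$, with $f_i:\mathbb{R}^p\to\mathbb{R}$. Norms: $\|\cdot\|$ is the Frobenius norm for vectors and $n\times p$ matrices and the spectral norm for square matrices. $\mathbf{1}\in\mathbb{R}^n$ is the all-ones column vector. Network assumption: the $n$ agents are the vertices of an undirected connected graph, and $\mathbf{W}=[w_{ij}]\in\mathbb{R}^{n\times n}$ is nonnegative with $\mathbf{W}\mathbf{1}=\mathbf{1}$ and $\mathbf{1}^{\top}\mathbf{W}=\mathbf{1}^{\top}$, where agent $i$ can receive information from agent $j$ if and only if $w_{ij}>0$. Let $\rho_w$ be the spectral norm of $\mathbf{W}-\frac1n\mathbf{1}\mathbf{1}^{\top}$; it satisfies $\rho_w<1$. Put $s=1-\rho_w$. Function assumption: for each $i$ there are constants $\mu_i,L_i>0$ such that for all $\mathbf{x},\mathbf{x}'\in\mathbb{R}^p$, $\langle\nabla f_i(\mathbf{x})-\nabla f_i(\mathbf{x}'),\mathbf{x}-\mathbf{x}'\rangle\ge\mu_i\|\mathbf{x}-\mathbf{x}'\|^2$ and $\|\nabla f_i(\mathbf{x})-\nabla f_i(\mathbf{x}')\|\le L_i\|\mathbf{x}-\mathbf{x}'\|$. Put $\mu=\frac1n\sum_i\mu_i$ and $L=\max_i L_i$. Let $\mathbf{x}^*\in\mathbb{R}^{1\times p}$ be the unique minimizer of $f$ (as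 a row vector). General compression assumption: the (possibly random) operator $\mathcal{C}:\mathbb{R}^p\to\mathbb{R}^p$ satisfies, for all $\mathbf{x}\in\mathbb{R}^p$, $\mathbb{E}_{\mathcal{C}}\|\mathcal{C}(\mathbf{x})-\mathbf{x}\|^2\le C\|\mathbf{x}\|^2$ and $\mathbb{E}_{\mathcal{C}}\|\mathcal{C}(\mathbf{x})/r-\mathbf{x}\|^2\le(1-\delta)\|\mathbf{x}\|^2$, with constants $C\ge0$, $\delta\in(0,1]$, $r>0$. Expectation is over the internal randomness of $\mathcal{C}$. For $\mathbf{Z}\in\mathbb{R}^{n\times p}$, $\mathcal{C}(\mathbf{Z})$ means applying $\mathcal{C}$ to each row, with independent randomness for each agent (row) and each call/iteration, so that, for each row $\mathbf{z}$ of the matrix being compressed, the bounds $\mathbb{E}\|\mathcal{C}(\mathbf{z})-\mathbf{z}\|^2\le C\|\mathbf{z}\|^2$ and $\mathbb{E}\|\mathcal{C}(\mathbf{z})/r-\mathbf{z}\|^2\le(1-\delta)\|\mathbf{z}\|^2$ hold with $\mathbb{E}$ taken conditionally on the past. C-GT iteration: agent $i$ has step-size $\eta_i>0$; $\mathbf{D}=\mathrm{diag}(\eta_1,\dots,\eta_n)$, $\bar\eta=\frac1n\sum_i\eta_i$, $\hat\eta=\max_i\eta_i$. Parameters: consensus step-size $\gamma$, scaling parameters $\alpha_x,\alpha_y$. For $\mathbf{X}\in\mathbb{R}^{n\times p}$ with rows $\mathbf{x}_i^{\top}$, $\nabla\mathbf{F}(\mathbf{X})\in\mathbb{R}^{n\times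 p}$ has rows $\nabla f_i(\mathbf{x}_i)^{\top}$. Given arbitrary (deterministic) $\mathbf{X}^0,\mathbf{H}_x^0,\mathbf{H}_y^0\in\mathbb{R}^{n\times p}$ and $\mathbf{Y}^0=\nabla\mathbf{F}(\mathbf{X}^0)$, for $k\ge0$: $\mathbf{Q}_x^k=\mathcal{C}(\mathbf{X}^k-\mathbf{H}_x^k)$, $\widehat{\mathbf{X}}^k=\mathbf{H}_x^k+\mathbf{Q}_x^k$, $\mathbf{H}_x^{k+1}=(1-\alpha_x)\mathbf{H}_x^k+\alpha_x\widehat{\mathbf{X}}^k$; $\mathbf{Q}_y^k=\mathcal{C}(\mathbf{Y}^k-\mathbf{H}_y^k)$, $\widehat{\mathbf{Y}}^k=\mathbf{H}_y^k+\mathbf{Q}_y^k$, $\mathbf{H}_y^{k+1}=(1-\alpha_y)\mathbf{H}_y^k+\alpha_y\widehat{\mathbf{Y}}^k$; $\mathbf{X}^{k+1}=\mathbf{X}^k-\gamma(\mathbf{I}-\mathbf{W})\widehat{\mathbf{X}}^k-\mathbf{D}\mathbf{Y}^k$; $\mathbf{Y}^{k+1}=\mathbf{Y}^k-\gamma(\mathbf{I}-\mathbf{W})\widehat{\mathbf{Y}}^k+\nabla\mathbf{F}(\mathbf{X}^{k+1})-\nabla\mathbf{F}(\mathbf{X}^k)$. Averages: $\overline{\mathbf{X}}^k=\frac1n\mathbf{1}^{\top}\mathbf{X}^k\in\mathbb{R}^{1\times p}$. *)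

(* Defs.v *)
From HB Require Import structures.
From mathcomp Require Import all_boot all_order all_algebra finmap.
From mathcomp Require Import all_classical all_reals all_analysis.

Set Implicit Arguments.
Unset Strict Implicit.
Unset Printing Implicit Defensive.

Import Order.TTheory GRing.Theory Num.Theory.
Import numFieldNormedType.Exports.

Local Open Scope classical_set_scope.
Local Open Scope ring_scope.

Section LinearAlgebra.
Context {R : realType}.

(* The library norm on matrices is the max norm, hence the separate definition. *)
Definition frob {m n : nat} (A : 'M[R]_(m, n)) : R :=
  Num.sqrt (\sum_(i < m) \sum_(j < n) A i j ^+ 2).

(* Operator norm induced by the Euclidean norm. *)
Definition spectral_norm {n : nat} (A : 'M[R]_n) : R :=
  sup [set frob (A *m v) | v in [set v : 'cV[R]_n | frob v <= 1]].

Definition inner {p : nat} (u v : 'rV[R]_p) : R := \sum_(j < p) u 0 j * v 0 j.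

Definition ones (n : nat) : 'cV[R]_n := const_mx 1.

(* The mean of the rows. *)
Definition avg {n p : nat} (X : 'M[R]_(n, p)) : 'rV[R]_p :=
  n%:R^-1 *: ((ones n)^T *m X).

End LinearAlgebra.

Section Network.
Context {R : realType} {n : nat}.

Definition rho_w (W : 'M[R]_n) : R :=
  spectral_norm (W - n%:R^-1 *: (ones n *m (ones n)^T)).

(* [e] is the adjacency relation of a simple graph; the diagonal weights are
   only required to be nonnegative.  [rho_w W < 1] is a separate clause because
   it does not follow from the others: the 2 x 2 swap matrix has [rho_w = 1]. *)
Record network (e : rel 'I_n) (W : 'M[R]_n) : Prop := Network {
  network_sym : symmetric e;
  network_irr : irreflexive e;
  network_connected : forall i j, connect e i j;
  network_ge0 : forall i j, 0 <= W i j;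
  network_row : W *m ones n = ones n;
  network_col : (ones n)^T *m W = (ones n)^T;
  network_edge : forall i j, i != j -> (0 < W i j) = e i j;
  network_rho : rho_w W < 1 }.

End Network.

Section Costs.
Context {R : realType} {p : nat}.

Definition grad (f : 'rV[R]_p -> R) (x : 'rV[R]_p) : 'rV[R]_p :=
  \row_(j < p) 'D_(delta_mx 0 j) f x.

Record strongly_convex_smooth (mu L : R) (f : 'rV[R]_p -> R) : Prop :=
  StronglyConvexSmooth {
  scs_mu_gt0 : 0 < mu;
  scs_L_gt0 : 0 < L;
  scs_diff : forall x, differentiable f x;
  scs_mono : forall x x',
    mu * frob (x - x') ^+ 2 <= inner (grad f x - grad f x') (x - x');
  scs_lip : forall x x', frob (grad f x - grad f x') <= L * frob (x - x') }.

Definition avg_cost {n : nat} (f : 'I_n -> 'rV[R]_p -> R) (x : 'rV[R]_p) : R :=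
  n%:R^-1 * \sum_(i < n) f i x.

Definition gradF {n : nat} (f : 'I_n -> 'rV[R]_p -> R) (X : 'M[R]_(n, p)) :
    'M[R]_(n, p) :=
  \matrix_(i < n) grad (f i) (row i X).

End Costs.

Section Probability.
Context {R : realType}.

Definition mutually_independent {dO dS : measure_display}
    {Omega : measurableType dO} {S : measurableType dS}
    (P : probability Omega R) (I : choiceType) (X : I -> {RV P >-> S}) : Prop :=
  forall (J : {fset I}) (A : I -> set S),
    (forall i, i \in J -> measurable (A i)) ->
    (P (\bigcap_(i in [set` J]) (X i @^-1` A i)) =
     \big[*%E/1%E]_(i <- J) P (X i @^-1` A i))%E.

(* A random operator on R^p is a map [C s x] of a random seed [s] with law [nu]
   and of the vector [x].  It is jointly measurable; R^p carries the product
   sigma-algebra, which the library provides on tuples. *)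
Record compressor {dS : measure_display} {S : measurableType dS}
    (nu : probability S R) {p : nat} (C : S -> 'rV[R]_p -> 'rV[R]_p)
    (Cc delta r : R) : Prop := Compressor {
  comp_Cc_ge0 : 0 <= Cc;
  comp_delta_gt0 : 0 < delta;
  comp_delta_le1 : delta <= 1;
  comp_r_gt0 : 0 < r;
  comp_meas : forall j : 'I_p,
    measurable_fun [set: S * p.-tuple R]
      (fun u => C u.1 (\row_(l < p) tnth u.2 l) 0 j);
  comp_err : forall x,
    ('E_nu[fun s => (frob (C s x - x) ^+ 2)%R] <= (Cc * frob x ^+ 2)%:E)%E;
  comp_contr : forall x,
    ('E_nu[fun s => (frob (r^-1 *: C s x - x) ^+ 2)%R]
      <= ((1 - delta) * frob x ^+ 2)%:E)%E }.

(* Seeds are indexed by the iteration, the compressed quantity ([false] for the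
   x-variables, [true] for the y-variables) and the agent. *)
Record iid_seeds {dO dS : measure_display}
    {Omega : measurableType dO} {S : measurableType dS}
    (P : probability Omega R) (nu : probability S R) {n : nat}
    (xi : nat * bool * 'I_n -> {RV P >-> S}) : Prop := IidSeeds {
  seeds_law : forall i A, measurable A -> distribution P (xi i) A = nu A;
  seeds_indep : mutually_independent xi }.

End Probability.

Section Algorithm.
Context {R : realType} {n p : nat}.

Record state : Type := State {
  stX : 'M[R]_(n, p);
  stHx : 'M[R]_(n, p);
  stY : 'M[R]_(n, p);
  stHy : 'M[R]_(n, p) }.

Variables (W : 'M[R]_n) (f : 'I_n -> 'rV[R]_p -> R) (eta : 'I_n -> R).
Variables (gamma alphax alphay : R).

(* [cx] and [cy] are the maps applied to the i-th row. *)
Definition cgt_step (cx cy : 'I_n -> 'rV[R]_p -> 'rV[R]_p) (z : state) : state :=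
  let: State X Hx Y Hy := z in
  let D := diag_mx (\row_(i < n) eta i) in
  let Qx := \matrix_(i < n) cx i (row i (X - Hx)) in
  let Xhat := Hx + Qx in
  let Qy := \matrix_(i < n) cy i (row i (Y - Hy)) in
  let Yhat := Hy + Qy in
  let X' := X - gamma *: ((1%:M - W) *m Xhat) - D *m Y in
  State X'
    ((1 - alphax) *: Hx + alphax *: Xhat)
    (Y - gamma *: ((1%:M - W) *m Yhat) + gradF f X' - gradF f X)
    ((1 - alphay) *: Hy + alphay *: Yhat).

Context {S : Type} (C : S -> 'rV[R]_p -> 'rV[R]_p).
Variables (X0 Hx0 Hy0 : 'M[R]_(n, p)).

Fixpoint cgt (seed : nat * bool * 'I_n -> S) (k : nat) : state :=
  if k is k'.+1 then
    cgt_step (fun i => C (seed (k', false, i))) (fun i => C (seed (k', true, i)))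
      (cgt seed k')
  else State X0 Hx0 (gradF f X0) Hy0.

End Algorithm.

Section Rates.
Context {R : realType}.

Definition linear_rate (u : nat -> \bar R) (q : R) : Prop :=
  exists c : R, forall k : nat, (u k <= (c * q ^+ k)%:E)%E.

End Rates.

(* Main.v *)
Require Import Defs.
From HB Require Import structures.
From mathcomp Require Import all_boot all_order all_algebra finmap.
From mathcomp Require Import all_classical all_reals all_analysis.
From mathcomp Require Import measurable_realfun ring lra.

(* Five mean square errors are tracked: the optimality error of the average of
   X, the consensus error of X, the deviation of the tracker Y from its average,
   and the distances of X and Y to the reference states Hx and Hy.  Pathwise,
   each error after one step is bounded by a nonnegative combination of the five
   errors before it and of the compression residuals.  The seeds of step k are
   independent of the past, so the mean of a residual is bounded, by Fubini, by a
   multiple of the mean of the corresponding distance to the reference state.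
   This gives a nonnegative linear system w_(k+1) <= A w_k, and the conditions on
   gamma and on the step-sizes allow a positive vector v with
   A v <= (1 - M etahat mu / 2) v, whence w_k <= K (1 - M etahat mu / 2)^k v by
   induction.  All quantities are nonnegative, so extended-real integrals
   suffice and integrability never has to be established separately. *)

Import Order.TTheory GRing.Theory Num.Theory.
Import numFieldNormedType.Exports.

Local Open Scope classical_set_scope.
Local Open Scope ring_scope.

(** * Frobenius and spectral norms *)

Section Lin.
Context {R : realType}.

(** Each compressed difference enters through two residuals. The estimate [Xhat] is [X] plus the
    unscaled residual, whose size is governed by [Cc] and may be large; the new reference state is
    [Hx + alphax *: Qx], so the new distance starts from the residual scaled by [r^-1], which
    contracts by [1 - delta]. The large residual is harmless because gossip multiplies its square by
    [gamma ^ 2]; the constant [m] records how small [gamma] must be for the contraction to win. The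
    rate comes from the optimality error: averaged over the agents, the iteration is gradient
    descent with step [etabar], whose gain [etabar * mu] is at least [M * etahat * mu], and half of
    the gain is kept to absorb the coupling with the other errors. The other four errors must
    decrease at least as fast. This is visible once the drop [M * etahat * mu / 2] is written as
    [gamma] times a quantity of at most [s / 60]: compared with the gossip contraction
    [1 - gamma * s] it is almost nothing. *)

Lemma frob_ge0 m n (A : 'M[R]_(m, n)) : 0 <= frob A.
Proof. exact: sqrtr_ge0. Qed.

Lemma frob2E m n (A : 'M[R]_(m, n)) :
  frob A ^+ 2 = \sum_(i < m) \sum_(j < n) A i j ^+ 2.
Proof.
rewrite sqr_sqrtr//.
by apply: sumr_ge0 => i _; apply: sumr_ge0 => j _; exact: sqr_ge0.
Qed.

Lemma frob2_rows m n (A : 'M[R]_(m, n)) :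
  frob A ^+ 2 = \sum_(i < m) frob (row i A) ^+ 2.
Proof.
rewrite frob2E; apply: eq_bigr => i _; rewrite frob2E big_ord1.
by apply: eq_bigr => j _; rewrite mxE.
Qed.

Lemma entry_le_frob m q (A : 'M[R]_(m, q)) i j : `|A i j| <= frob A.
Proof.
rewrite -(@ler_pXn2r _ 2)// ?nnegrE ?frob_ge0// real_normK ?num_real// frob2E.
rewrite (bigD1 i)//= (bigD1 j)//= -addrA lerDl addr_ge0//.
  by apply: sumr_ge0 => l _; exact: sqr_ge0.
by apply: sumr_ge0 => l _; apply: sumr_ge0 => l' _; exact: sqr_ge0.
Qed.

Lemma sum2D m n (F G : 'I_m -> 'I_n -> R) :
  \sum_i \sum_j (F i j + G i j) = \sum_i \sum_j F i j + \sum_i \sum_j G i j.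
Proof. by rewrite -big_split; apply: eq_bigr => i _; rewrite -big_split. Qed.

Lemma sum2Z m n a (F : 'I_m -> 'I_n -> R) :
  \sum_i \sum_j (a * F i j) = a * \sum_i \sum_j F i j.
Proof. by rewrite mulr_sumr; apply: eq_bigr => i _; rewrite mulr_sumr. Qed.

Lemma frob2Z m n a (A : 'M[R]_(m, n)) : frob (a *: A) ^+ 2 = a ^+ 2 * frob A ^+ 2.
Proof.
rewrite !frob2E -sum2Z; apply: eq_bigr => i _; apply: eq_bigr => j _.
by rewrite mxE exprMn.
Qed.

Lemma frobN m n (A : 'M[R]_(m, n)) : frob (- A) = frob A.
Proof.
by congr Num.sqrt; apply: eq_bigr => i _; apply: eq_bigr => j _; rewrite mxE sqrrN.
Qed.

(** Jensen's inequality for the square, entry by entry, after writing [d] as [c * (d / c)]; the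
    deficit is a weighted sum of squared pairwise differences. Only [c] has to be positive, which
    admits [gamma = 1] and [rho_w W = 0] in the gossip estimate. *)
Lemma frob2_convex3 m n a b c (A B D : 'M[R]_(m, n)) :
  0 <= a -> 0 <= b -> 0 < c -> a + b + c = 1 ->
  frob (a *: A + b *: B + D) ^+ 2 <= a * frob A ^+ 2 + b * frob B ^+ 2 + c^-1 * frob D
    ^+ 2.
Proof.
move=> a0 b0 c0 abc; rewrite !frob2E -!sum2Z -!sum2D.
apply: ler_sum => i _; apply: ler_sum => j _; rewrite !mxE.
set x := A i j; set y := B i j; set d := D i j.
have -> : d = c * (d / c) by rewrite mulrC mulfVK// gt_eqF.
set z := d / c.
have -> : c^-1 * (c * z) ^+ 2 = c * z ^+ 2 by field; rewrite gt_eqF.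
rewrite -subr_ge0.
have -> : a * x ^+ 2 + b * y ^+ 2 + c * z ^+ 2 - (a * x + b * y + c * z) ^+ 2 =
  a * b * (x - y) ^+ 2 + a * c * (x - z) ^+ 2 + b * c * (y - z) ^+ 2.
  have -> : c = 1 - a - b by rewrite -abc; ring.
  by ring.
by rewrite !addr_ge0// mulr_ge0 ?sqr_ge0// mulr_ge0// ltW.
Qed.

Lemma frob2_convex2 m n t (A B : 'M[R]_(m, n)) :
  0 < t -> t < 1 ->
  frob (A + B) ^+ 2 <= (1 - t)^-1 * frob A ^+ 2 + t^-1 * frob B ^+ 2.
Proof.
move=> t0 t1; have t1' : 0 < 1 - t by rewrite subr_gt0.
have := @frob2_convex3 _ _ (1 - t) 0 t ((1 - t)^-1 *: A) 0 B.
rewrite scaler0 addr0 scalerA mulfV ?gt_eqF// scale1r mul0r !addr0 frob2Z.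
have -> x : (1 - t) * ((1 - t)^-1 ^+ 2 * x) = (1 - t)^-1 * x.
  by field; rewrite gt_eqF.
apply => //; lra.
Qed.

Lemma frob2D2 m n (A B : 'M[R]_(m, n)) :
  frob (A + B) ^+ 2 <= 2 * (frob A ^+ 2 + frob B ^+ 2).
Proof.
have := @frob2_convex2 _ _ 2^-1 A B.
have -> : (1 - 2^-1)^-1 = 2 :> R by field.
rewrite invrK -mulrDr; apply; lra.
Qed.

Lemma frob2D3 m n (A B D : 'M[R]_(m, n)) :
  frob (A + B + D) ^+ 2 <= 3 * (frob A ^+ 2 + frob B ^+ 2 + frob D ^+ 2).
Proof.
have := @frob2_convex3 _ _ 3^-1 3^-1 3^-1 (3 *: A) (3 *: B) D.
rewrite !scalerA mulVf// !scale1r !frob2Z invrK.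
have E x : 3^-1 * (3 ^+ 2 * x) = 3 * x :> R by field.
rewrite !E -!mulrDr; apply; lra.
Qed.

(** Lagrange's identity: twice the deficit is the double sum of the squares of
    [a i * b j - a j * b i]. *)
Lemma cauchy_schwarz_sum (I : finType) (a b : I -> R) :
  (\sum_i a i * b i) ^+ 2 <= (\sum_i a i ^+ 2) * (\sum_i b i ^+ 2).
Proof.
have h : 0 <= \sum_i \sum_j (a i * b j - a j * b i) ^+ 2.
  by apply: sumr_ge0 => i _; apply: sumr_ge0 => j _; exact: sqr_ge0.
have E : \sum_i \sum_j (a i * b j - a j * b i) ^+ 2 =
  2 * ((\sum_i a i ^+ 2) * (\sum_i b i ^+ 2) - (\sum_i a i * b i) ^+ 2).
  transitivity (\sum_i \sum_j (a i ^+ 2 * b j ^+ 2 + b i ^+ 2 * a j ^+ 2 - 2 * (a i * b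
    i) * (a j * b j))).
    by apply: eq_bigr => i _; apply: eq_bigr => j _; ring.
  under eq_bigr do rewrite sumrB big_split/= -!mulr_sumr.
  rewrite sumrB big_split/= -!mulr_suml -mulr_sumr expr2; ring.
by move: h; rewrite E pmulr_rge0// subr_ge0.
Qed.

Lemma frob_cV n (v : 'cV[R]_n) : frob v ^+ 2 = \sum_i v i 0 ^+ 2.
Proof. by rewrite frob2E; apply: eq_bigr => i _; rewrite big_ord1. Qed.

Lemma frob_mulmx_col n (A : 'M[R]_n) (v : 'cV[R]_n) :
  frob (A *m v) ^+ 2 <= frob A ^+ 2 * frob v ^+ 2.
Proof.
rewrite [X in _ <= X * _]frob2E !frob_cV mulr_suml ler_sum// => i _; rewrite mxE.
exact: cauchy_schwarz_sum.
Qed.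

Lemma frob_eq0 m n (A : 'M[R]_(m, n)) : frob A = 0 -> A = 0.
Proof.
move=> h; apply/matrixP => i j; rewrite mxE; apply/eqP; rewrite -normr_le0 -h.
exact: entry_le_frob.
Qed.

(** Makes [spectral_norm] a genuine upper bound, since [sup] takes a default value on an unbounded
    set. *)
Lemma spectral_norm_has_sup n (A : 'M[R]_n) :
  has_sup [set frob (A *m v) | v in [set v : 'cV[R]_n | frob v <= 1]].
Proof.
split.
  exists (frob (A *m (0 : 'cV_n))), 0 => //=.
  by rewrite /frob big1 ?sqrtr0// => i _; rewrite big1// => j _; rewrite mxE expr0n.
exists (frob A) => _ [v /= v1 <-].
rewrite -(@ler_pXn2r _ 2)// ?nnegrE ?frob_ge0//.
apply: le_trans (frob_mulmx_col _ _ _) _; rewrite -[leRHS]mulr1.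
by apply: ler_wpM2l; rewrite ?sqr_ge0// exprn_ile1// frob_ge0.
Qed.

Lemma spectral_norm_ge0 n (A : 'M[R]_n) : 0 <= spectral_norm A.
Proof.
have [[x Ax] ub] := spectral_norm_has_sup n A.
apply: le_trans (_ : x <= _); first by case: Ax => v _ <-; exact: frob_ge0.
by apply: ub_le_sup.
Qed.

Lemma frob2_mulmx_cV n (A : 'M[R]_n) (v : 'cV[R]_n) :
  frob (A *m v) ^+ 2 <= spectral_norm A ^+ 2 * frob v ^+ 2.
Proof.
have [v0|v0] := eqVneq (frob v) 0.
  by rewrite (frob_eq0 _ _ _ v0) mulmx0 -(frob_eq0 _ _ _ v0) v0 expr0n mulr0.
have vp : 0 < frob v by rewrite lt_def v0 frob_ge0.
have h : frob (A *m ((frob v)^-1 *: v)) <= spectral_norm A.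
  apply: ub_le_sup; first by have [] := spectral_norm_has_sup n A.
  exists ((frob v)^-1 *: v) => //=.
  rewrite -(@ler_pXn2r _ 2)// ?nnegrE ?frob_ge0// frob2Z expr1n exprVn mulVf//.
  by rewrite expf_neq0.
have : frob (A *m ((frob v)^-1 *: v)) ^+ 2 <= spectral_norm A ^+ 2.
  by rewrite ler_pXn2r// nnegrE ?frob_ge0// spectral_norm_ge0.
rewrite -scalemxAr frob2Z exprVn ler_pdivrMl ?exprn_gt0//.
by rewrite mulrC.
Qed.

Lemma frob2_cols m n (A : 'M[R]_(m, n)) : frob A ^+ 2 = \sum_j frob (col j A) ^+ 2.
Proof.
rewrite frob2E exchange_big; apply: eq_bigr => j _; rewrite frob_cV.
by apply: eq_bigr => i _; rewrite mxE.
Qed.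

Lemma frob2_mulmx n p (A : 'M[R]_n) (X : 'M[R]_(n, p)) :
  frob (A *m X) ^+ 2 <= spectral_norm A ^+ 2 * frob X ^+ 2.
Proof.
rewrite frob2_cols [X in _ <= _ * X]frob2_cols mulr_sumr ler_sum// => j _.
rewrite colE -mulmxA -colE; exact: frob2_mulmx_cV.
Qed.

End Lin.

(** * Independence and measurability *)

(** For fixed [E], both sides are finite measures in [B] that agree on the pi-system [G], and such
    measures are determined by their values there. *)
Lemma indep_g_sigma_algebra {d} {R : realType} {T : measurableType d}
    (P : probability T R) (G : set (set T)) (E : set T) :
  G `<=` measurable -> setI_closed G -> G setT -> measurable E ->
  (forall B, G B -> (P (E `&` B) = P E * P B)%E) ->
  forall B, <<s G >> B -> (P (E `&` B) = P E * P B)%E.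
Proof.
move=> Gm GI GT mE EG B sB.
have PE0 : 0 <= fine (P E) by exact: fine_ge0.
pose m1 := mrestr P mE; pose m2 := mscale (NngNum PE0) P.
have PEf : (fine (P E))%:E = P E by rewrite fineK// fin_num_measure.
have : m1 B = m2 B.
  apply: (g_sigma_algebra_measure_unique G Gm (fun=> setT)) => //.
  - by rewrite bigcup_const.
  - by move=> A GA; rewrite /m1/= /mrestr /m2/= /mscale/= setIC EG// PEf.
  - move=> _; rewrite /m1/= /mrestr setTI.
    by rewrite (le_lt_trans (probability_le1 P mE))// ltry.
by rewrite /m1/= /mrestr /m2/= /mscale/= setIC PEf.
Qed.

(** Independence makes the law of the pair the product measure, which its values on rectangles
    determine; Tonelli then integrates the seed first, with the other variable frozen. This takes
    the place of a conditional expectation given the past. *)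
Lemma integral_indep_pair {d dS dV} {R : realType} {T : measurableType d}
    {S : measurableType dS} {V : measurableType dV} (P : probability T R)
    (nu : probability S R) (X : {RV P >-> S}) (Z : {RV P >-> V})
    (phi : S * V -> \bar R) :
  (forall A, measurable A -> P (X @^-1` A) = nu A) ->
  (forall A B, measurable A -> measurable B ->
     (P (X @^-1` A `&` Z @^-1` B) = P (X @^-1` A) * P (Z @^-1` B))%E) ->
  measurable_fun setT phi -> (forall z, 0 <= phi z)%E ->
  (\int[P]_w phi (X w, Z w) = \int[P]_w \int[nu]_s phi (s, Z w))%E.
Proof.
move=> XP XZ mphi phi0.
pose J w := (X w, Z w).
have mJ : measurable_fun setT J by apply/measurable_fun_pair.
pose JJ : {mfun T >-> (S * V)%type} :=
  HB.pack J (isMeasurableFun.Build _ _ _ _ J mJ).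
have QJE : forall U, measurable U -> (nu \x distribution P Z)%E U = distribution P JJ U.
  apply: product_measure_unique => A B mA mB.
  by have := XZ A B mA mB; rewrite XP.
transitivity (\int[distribution P JJ]_z phi z)%E.
  by rewrite ge0_integral_distribution.
transitivity (\int[nu \x distribution P Z]_z phi z)%E.
  by apply: eq_measure_integral => A mA _; exact/esym/QJE.
rewrite fubini_tonelli2// ge0_integral_distribution//.
  exact: measurable_fun_fubini_tonelli_G.
by move=> w; apply: integral_ge0.
Qed.

(** * Sigma-algebras generated by finitely many seeds *)

Section Cylinders.
Context {d dS} {R : realType} {T : measurableType d} {S : measurableType dS}
  {P : probability T R} {I : choiceType} (xi : I -> {RV P >-> S}).

(* A pi-system generating the sigma-algebra of the seeds indexed by [J]. *)
Definition cylinders (J : {fset I}) : set (set T) :=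
  [set \bigcap_(i in [set` J]) (xi i @^-1` A i)
     | A in [set A : I -> set S | forall i, measurable (A i)]].

Lemma cylinders_measurable J : cylinders J `<=` measurable.
Proof.
move=> _ [A mA <-]; apply: fin_bigcap_measurable; first exact: finite_fset.
by move=> i _; exact: measurable_funPTI.
Qed.

Lemma cylinders_setI J : setI_closed (cylinders J).
Proof.
move=> _ _ [A mA <-] [B mB <-]; exists (fun i => A i `&` B i).
  by move=> i; exact: measurableI.
by rewrite -bigcapI; apply: eq_bigcapr => i _; rewrite preimage_setI.
Qed.

Lemma cylinders_setT J : cylinders J setT.
Proof.
exists (fun=> setT) => //.
by apply/seteqP; split => // w _ i _.
Qed.

Lemma cylinders_sub (J J' : {fset I}) :
  (J `<=` J')%fset -> cylinders J `<=` cylinders J'.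
Proof.
move=> JJ' _ [A mA <-]; exists (fun i => if i \in J then A i else setT).
  by move=> i; case: ifP.
apply/seteqP; split => w h i /= iJ.
  by have := h i (fsubsetP JJ' _ iJ); rewrite /= iJ.
by case: ifP => // iJ'; exact: h.
Qed.

Lemma measurable_cylinders (J J' : {fset I}) d' (V : measurableType d') (f : T -> V) :
  (J `<=` J')%fset ->
  measurable_fun [set: g_sigma_algebraType (cylinders J)] f ->
  measurable_fun [set: g_sigma_algebraType (cylinders J')] f.
Proof.
move=> JJ' mf _ B mB; have := mf measurableT B mB; rewrite !setTI.
by apply: sub_sigma_algebra2; exact: cylinders_sub.
Qed.

Lemma measurable_seed_cylinders (J : {fset I}) i : i \in J ->
  measurable_fun [set: g_sigma_algebraType (cylinders J)] (xi i).
Proof.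
move=> iJ _ B mB; rewrite setTI; apply: sub_sigma_algebra.
exists (fun j => if j == i then B else setT); first by move=> j; case: ifP.
apply/seteqP; split => w.
  by move=> /(_ i iJ) /=; rewrite eqxx.
by move=> wB j _ /=; case: eqP => // ->.
Qed.

Lemma measurable_of_cylinders (J : {fset I}) d' (V : measurableType d') (f : T -> V) :
  measurable_fun [set: g_sigma_algebraType (cylinders J)] f ->
  measurable_fun [set: T] f.
Proof.
move=> mf _ B mB; have := mf measurableT B mB; rewrite !setTI.
by apply: smallest_sub; [exact: sigma_algebra_measurable|exact: cylinders_measurable].
Qed.

(** On a cylinder this is mutual independence used twice, over [J] and over [J] with [i] added;
    [indep_g_sigma_algebra] extends it to every event generated by the cylinders. *)
Lemma indep_cylinders (J : {fset I}) i d' (V : measurableType d') (Z : T -> V) A B :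
  mutually_independent xi -> i \notin J ->
  measurable_fun [set: g_sigma_algebraType (cylinders J)] Z ->
  measurable A -> measurable B ->
  (P (xi i @^-1` A `&` Z @^-1` B) = P (xi i @^-1` A) * P (Z @^-1` B))%E.
Proof.
move=> ind iJ mZ mA mB.
apply: (@indep_g_sigma_algebra _ _ _ P (cylinders J)).
- exact: cylinders_measurable.
- exact: cylinders_setI.
- exact: cylinders_setT.
- exact: measurable_funPTI.
- move=> _ [A' mA' <-].
  have h1 := ind J A' (fun i _ => mA' i).
  pose A2 j := if j == i then A else A' j.
  have mA2 j : measurable (A2 j) by rewrite /A2; case: ifP.
  have h2 := ind (i |` J)%fset A2 (fun i _ => mA2 i).
  have E1 : \bigcap_(j in [set` (i |` J)%fset]) (xi j @^-1` A2 j) =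
     xi i @^-1` A `&` \bigcap_(j in [set` J]) (xi j @^-1` A' j).
    apply/seteqP; split => w.
      move=> h; split.
        by have := h i (fset1U1 _ _); rewrite /= /A2 eqxx.
      move=> j jJ; have := h j (fset1Ur _ jJ); rewrite /= /A2.
      by case: eqP => // ji; move: iJ; rewrite -ji jJ.
    move=> [h1' h2'] j /=; rewrite in_fset1U /A2; case: eqP => [-> //|_ /= jJ].
    exact: h2'.
  rewrite E1 in h2; rewrite h2 h1 big_fsetU1//= /A2 eqxx; congr (_ * _)%E.
  rewrite big_seq [RHS]big_seq; apply: eq_bigr => j jJ.
  by case: eqP => // ji; move: iJ; rewrite -ji jJ.
- by have := mZ measurableT B mB; rewrite setTI.
Qed.

End Cylinders.

Section MeasurableMatrix.
Context {d} {R : realType} {T : measurableType d}.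

Definition measurable_mx {m n} (X : T -> 'M[R]_(m, n)) :=
  forall i j, measurable_fun setT (fun w => X w i j).

Lemma measurable_mx_cst m n (A : 'M[R]_(m, n)) : measurable_mx (fun=> A).
Proof. by move=> i j; exact: measurable_cst. Qed.

Lemma measurable_mxD m n (X Y : T -> 'M[R]_(m, n)) : measurable_mx X -> measurable_mx Y ->
  measurable_mx (fun w => X w + Y w).
Proof.
move=> mX mY i j; under eq_fun do rewrite mxE.
exact: measurable_funD.
Qed.

Lemma measurable_mxZ m n a (X : T -> 'M[R]_(m, n)) : measurable_mx X ->
  measurable_mx (fun w => a *: X w).
Proof.
move=> mX i j; under eq_fun do rewrite mxE.
by apply: measurable_funM => //; exact: mX.
Qed.

Lemma measurable_mxB m n (X Y : T -> 'M[R]_(m, n)) : measurable_mx X -> measurable_mx Y ->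
  measurable_mx (fun w => X w - Y w).
Proof.
move=> mX mY; apply: measurable_mxD => //.
rewrite (_ : (fun w => - Y w) = (fun w => -1 *: Y w)); first exact: measurable_mxZ.
by apply/funext => w; rewrite scaleN1r.
Qed.

Lemma measurable_mx_mul m n q (A : 'M[R]_(q, m)) (X : T -> 'M[R]_(m, n)) :
  measurable_mx X -> measurable_mx (fun w => A *m X w).
Proof.
move=> mX i j; under eq_fun do rewrite mxE.
apply: measurable_sum => k; apply: measurable_funM => //; exact: mX.
Qed.

Lemma measurable_mx_row m n (X : T -> 'M[R]_(m, n)) i : measurable_mx X ->
  measurable_mx (fun w => row i (X w)).
Proof.
move=> mX i' j; rewrite (_ : (fun _ => _) = fun w => X w i j); first exact: mX.
by apply/funext => w; rewrite mxE.
Qed.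

Lemma measurable_frob2 m n (X : T -> 'M[R]_(m, n)) : measurable_mx X ->
  measurable_fun setT (fun w => frob (X w) ^+ 2).
Proof.
move=> mX.
rewrite (_ : (fun _ => _) = fun w => \sum_i \sum_j X w i j ^+ 2).
  apply: measurable_sum => i; apply: measurable_sum => j.
  by apply: measurable_funX; exact: mX.
apply/funext => w; rewrite sqr_sqrtr//.
by apply: sumr_ge0 => i _; apply: sumr_ge0 => j _; exact: sqr_ge0.
Qed.

End MeasurableMatrix.

(** * Measurability of Lipschitz functions of random vectors *)

Section LipschitzMeasurable.
Context {d} {R : realType} {T : measurableType d}.

Lemma measurable_countable_image {U : countType} {V : Type} (k : T -> U) (g : U -> R) :
  (forall u, measurable (k @^-1` [set u])) -> measurable_fun setT (g \o k).
Proof.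
move=> mk _ B mB; rewrite setTI.
rewrite (_ : _ @^-1` _ = \bigcup_u (if g u \in B then k @^-1` [set u] else set0)).
  apply: countable_bigcupT_measurable => // u; by case: ifP.
apply/seteqP; split => w /=.
  by move=> Bw; exists (k w) => //; rewrite mem_set.
by move=> [u _]; case: ifPn => // /set_mem Bu /= ->.
Qed.

(* The coordinates of [z] are rounded down to multiples of [1 / m]; the rounded
   vector takes countably many values, so [g] of it is measurable, and the limit
   [m --> oo] gives back [g \o z]. *)
Lemma measurable_lipschitz p (g : 'rV[R]_p -> R) (L : R) (z : T -> 'rV[R]_p) :
  (forall x y, `|g x - g y| <= L * frob (x - y)) -> measurable_mx z ->
  measurable_fun setT (g \o z).
Proof.
move=> hL mz.
pose k (m : nat) w : 'rV[int]_p := \row_j Num.floor (m.+1%:R * z w 0 j).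
pose h (m : nat) (v : 'rV[int]_p) : 'rV[R]_p := \row_j (m.+1%:R^-1 * (v 0 j)%:~R).
apply: (@measurable_fun_cvg _ _ _ _ (fun m w => g (h m (k m w)))).
  move=> m; apply: (@measurable_countable_image _ unit (k m) (g \o h m)) => u.
  rewrite (_ : _ @^-1` _ = \bigcap_(j in [set: 'I_p])
     (fun w => m.+1%:R * z w 0 j) @^-1` `[(u 0 j)%:~R, (u 0 j + 1)%:~R[).
    apply: fin_bigcap_measurable => // j _; rewrite -[X in measurable X]setTI.
    apply: measurable_funM => //; exact: mz.
  apply/seteqP; split => w /=.
    by move=> <- j _ /=; rewrite mxE in_itv/= floor_le floorD1_gt.
  move=> hw; apply/rowP => j; rewrite mxE; apply/eqP.
  by have := hw j I; rewrite /= in_itv/= -floor_eq.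
move=> w _; apply/cvgrPdist_le => e e0.
(* Rounding moves each of the [p] coordinates by at most [1 / (m + 1)], hence the vector by at most
   [sqrt p / (m + 1)] in Frobenius norm. *)
pose K := `|L| * Num.sqrt p%:R.
have key m : `|g (z w) - g (h m (k m w))| <= K * harmonic m.
  apply: le_trans (hL _ _) _; apply: le_trans (_ : `|L| * frob (z w - h m (k m w)) <= _).
    by apply: ler_wpM2r; [exact: frob_ge0|exact: ler_norm].
  rewrite -mulrA; apply: ler_wpM2l => //.
  have h0 : 0 <= @harmonic R m by rewrite invr_ge0.
  rewrite -[harmonic m]ger0_norm// -sqrtr_sqr -sqrtrM// ler_wsqrtr// big_ord1.
  rewrite -[X in X%:R * _]card_ord mulr_natl -sumr_const ler_sum// => j _.
  rewrite !mxE -[X in X <= _]real_normK ?num_real// lerXn2r ?nnegrE//.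
  have m0 : (0 : R) < m.+1%:R by [].
  rewrite -(ler_pM2l m0) -[X in X * `|_|]gtr0_norm// -normrM mulrBr mulrA mulfV
    ?gt_eqF// mul1r.
  rewrite ger0_norm ?subr_ge0 ?floor_le// lerBlDl.
  by rewrite -[1]/(1%:~R) -intrD ltW// floorD1_gt.
have : K * harmonic m @[m --> \oo] --> (0 : R).
  by rewrite -[0](mulr0 K); apply: cvgM; [exact: cvg_cst|exact: cvg_harmonic].
move/cvgrPdist_le => /(_ e e0); apply: filterS => m.
rewrite sub0r normrN => hm; apply: le_trans (key m) _.
exact: le_trans (ler_norm _) hm.
Qed.

End LipschitzMeasurable.

(** * Random compression and its mean residual *)

Section Compress.
Context {R : realType} {n p : nat} {dS : measure_display} {S : measurableType dS}
  (C : S -> 'rV[R]_p -> 'rV[R]_p).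
Hypothesis mC : forall j : 'I_p, measurable_fun [set: S * p.-tuple R]
      (fun u => C u.1 (\row_(l < p) tnth u.2 l) 0 j).

Lemma measurable_tuple_of_row {d} {T : measurableType d} (z : T -> 'rV[R]_p) :
  measurable_mx z -> measurable_fun setT (fun w => [tuple z w 0 j | j < p]).
Proof.
move=> mz; apply/measurable_fun_tnthP => j.
rewrite (_ : _ \o _ = fun w => z w 0 j); first exact: mz.
by apply/funext => w /=; rewrite tnth_mktuple.
Qed.

Lemma row_of_tuple (v : 'rV[R]_p) : \row_(l < p) tnth [tuple v 0 j | j < p] l = v.
Proof. by apply/rowP => j; rewrite mxE tnth_mktuple. Qed.

Lemma measurable_mx_compress {d} {T : measurableType d} (s : T -> S) (z : T -> 'rV[R]_p) :
  measurable_fun setT s -> measurable_mx z -> measurable_mx (fun w => C (s w) (z w)).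
Proof.
move=> ms mz i j; rewrite (ord1 i).
rewrite (_ : (fun _ => _) =
  (fun u => C u.1 (\row_(l < p) tnth u.2 l) 0 j) \o
  (fun w => (s w, [tuple z w 0 j | j < p]))).
  apply: measurableT_comp => //; apply/measurable_fun_pair => //.
  exact: measurable_tuple_of_row.
by apply/funext => w /=; rewrite row_of_tuple.
Qed.

Lemma measurable_mx_compress_rows {d} {T : measurableType d} (s : 'I_n -> T -> S)
    (Z : T -> 'M[R]_(n, p)) :
  (forall i, measurable_fun setT (s i)) -> measurable_mx Z ->
  measurable_mx (fun w => \matrix_i C (s i w) (row i (Z w))).
Proof.
move=> ms mZ i j.
rewrite (_ : (fun _ => _) = fun w => C (s i w) (row i (Z w)) 0 j).
  by apply: measurable_mx_compress => //; exact: measurable_mx_row.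
by apply/funext => w; rewrite mxE.
Qed.

Section Step.
Variables (W : 'M[R]_n) (f : 'I_n -> 'rV[R]_p -> R) (eta : 'I_n -> R).
Variables (gamma alphax alphay : R) (Li : 'I_n -> R).
Hypothesis fL : forall i x y,
  frob (grad (f i) x - grad (f i) y) <= Li i * frob (x - y).

Lemma measurable_mx_gradF {d} {T : measurableType d} (X : T -> 'M[R]_(n, p)) :
  measurable_mx X -> measurable_mx (fun w => gradF f (X w)).
Proof.
move=> mX i j.
rewrite (_ : (fun _ => _) = (fun x => grad (f i) x 0 j) \o (fun w => row i (X w))).
  apply: (@measurable_lipschitz _ _ _ _ _ (Li i)); last exact: measurable_mx_row.
  move=> x y; apply: le_trans (fL i x y).
  by rewrite (_ : _ - _ = (grad (f i) x - grad (f i) y) 0 j) ?entry_le_frob// !mxE.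
by apply/funext => w /=; rewrite mxE.
Qed.

Definition measurable_state {d} {T : measurableType d} (z : T -> @state R n p) :=
  [/\ measurable_mx (fun w => stX (z w)), measurable_mx (fun w => stHx (z w)),
      measurable_mx (fun w => stY (z w)) & measurable_mx (fun w => stHy (z w))].

Lemma measurable_state_cgt_step {d} {T : measurableType d} (z : T -> @state R n p)
    (sx sy : 'I_n -> T -> S) :
  (forall i, measurable_fun setT (sx i)) -> (forall i, measurable_fun setT (sy i)) ->
  measurable_state z ->
  measurable_state (fun w => cgt_step W f eta gamma alphax alphay
    (fun i => C (sx i w)) (fun i => C (sy i w)) (z w)).
Proof.
move=> msx msy [mX mHx mY mHy].
have mXhat : measurable_mx (fun w => stHx (z w) +
    \matrix_i C (sx i w) (row i (stX (z w) - stHx (z w)))).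
  by apply: measurable_mxD => //; apply: (measurable_mx_compress_rows sx) => //;
    exact: measurable_mxB.
have mYhat : measurable_mx (fun w => stHy (z w) +
    \matrix_i C (sy i w) (row i (stY (z w) - stHy (z w)))).
  by apply: measurable_mxD => //; apply: (measurable_mx_compress_rows sy) => //;
    exact: measurable_mxB.
have mX' : measurable_mx (fun w => stX (cgt_step W f eta gamma alphax alphay
    (fun i => C (sx i w)) (fun i => C (sy i w)) (z w))).
  rewrite (_ : (fun _ => _) = fun w => stX (z w)
    - gamma *: ((1%:M - W) *m (stHx (z w) +
       \matrix_i C (sx i w) (row i (stX (z w) - stHx (z w)))))
    - diag_mx (\row_(i < n) eta i) *m stY (z w)).
    apply: measurable_mxB; last exact: measurable_mx_mul.
    by apply: measurable_mxB => //; apply: measurable_mxZ; apply: measurable_mx_mul.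
  by apply/funext => w; case: (z w).
split => //.
- rewrite (_ : (fun _ => _) = fun w => (1 - alphax) *: stHx (z w) +
     alphax *: (stHx (z w) +
       \matrix_i C (sx i w) (row i (stX (z w) - stHx (z w))))).
    by apply: measurable_mxD; exact: measurable_mxZ.
  by apply/funext => w; case: (z w).
- rewrite (_ : (fun _ => _) = fun w => stY (z w)
    - gamma *: ((1%:M - W) *m (stHy (z w) +
       \matrix_i C (sy i w) (row i (stY (z w) - stHy (z w)))))
    + gradF f (stX (cgt_step W f eta gamma alphax alphay
        (fun i => C (sx i w)) (fun i => C (sy i w)) (z w)))
    - gradF f (stX (z w))).
    apply: measurable_mxB; last exact: measurable_mx_gradF.
    apply: measurable_mxD; last exact: measurable_mx_gradF.
    by apply: measurable_mxB => //; apply: measurable_mxZ; apply: measurable_mx_mul.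
  by apply/funext => w; case: (z w).
- rewrite (_ : (fun _ => _) = fun w => (1 - alphay) *: stHy (z w) +
     alphay *: (stHy (z w) +
       \matrix_i C (sy i w) (row i (stY (z w) - stHy (z w))))).
    by apply: measurable_mxD; exact: measurable_mxZ.
  by apply/funext => w; case: (z w).
Qed.

Context {d : measure_display} {Omega : measurableType d} (P : probability Omega R)
  (nu : probability S R) (xi : nat * bool * 'I_n -> {RV P >-> S}).
Variables (X0 Hx0 Hy0 : 'M[R]_(n, p)).
Hypothesis hxi : iid_seeds nu xi.

(** Strictly earlier iterations only: the state after [k] steps depends on these seeds, and the
    seeds used in step [k] itself are fresh. *)
Definition past (k : nat) : {fset nat * bool * 'I_n} :=
  [fset x in [seq (nat_of_ord x.1.1, x.1.2, x.2)
                | x <- enum {: 'I_k * bool * 'I_n}]]%fset.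

Lemma in_past k t b i : ((t, b, i) \in past k) = (t < k)%N.
Proof.
rewrite inE; apply/mapP/idP => [[[[t' b'] i'] _ [-> _ _]] //|tk].
by exists (Ordinal tk, b, i); rewrite ?mem_enum.
Qed.

Definition cgt_state k w :=
  cgt W f eta gamma alphax alphay C X0 Hx0 Hy0 (fun i => xi i w) k.

(** Adaptedness of the iteration. Measurability with respect to [past k], rather than the full
    sigma-algebra, is what lets [indep_cylinders] apply to the seeds of step [k]. *)
Lemma measurable_state_cgt k :
  @measurable_state _ (g_sigma_algebraType (cylinders xi (past k))) (cgt_state k).
Proof.
elim: k => [|k IH]; first by split; exact: measurable_mx_cst.
have sub : (past k `<=` past k.+1)%fset.
  by apply/fsubsetP => -[[t b] i]; rewrite !in_past => /ltnW.
apply: (@measurable_state_cgt_step _ (g_sigma_algebraType (cylinders xi (past k.+1)))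
  (cgt_state k) (fun i w => xi (k, false, i) w)
   (fun i w => xi (k, true, i) w)).
- by move=> i; apply: measurable_seed_cylinders; rewrite in_past.
- by move=> i; apply: measurable_seed_cylinders; rewrite in_past.
- by case: IH => h1 h2 h3 h4; split => i j; apply: (measurable_cylinders _ _ _ _ _ _ sub);
  [exact: h1|exact: h2|exact: h3|exact: h4].
Qed.

(** The factor [a] serves both compression bounds: [a = 1] with [c = Cc], and [a = r^-1] with
    [c = 1 - delta]. Each row is independent of its seed, so the assumption is applied to the
    integral over [nu] with the row fixed; the rows are then summed. *)
Lemma expectation_compress_le k b (Z : Omega -> 'M[R]_(n, p)) (a c : R) :
  (forall x, (\int[nu]_s (frob (a *: C s x - x) ^+ 2)%:E <= (c * frob x ^+ 2)%:E)%E) ->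
  0 <= c ->
  @measurable_mx _ _ (g_sigma_algebraType (cylinders xi (past k))) _ _ Z ->
  (\int[P]_w (frob (a *: \matrix_i C (xi (k, b, i) w) (row i (Z w)) - Z w) ^+ 2)%:E
   <= c%:E * \int[P]_w (frob (Z w) ^+ 2)%:E)%E.
Proof.
move=> hc c0 mZ.
have mZO : measurable_mx Z by move=> i j;
  exact: (measurable_of_cylinders _ _ _ _ _ (mZ i j)).
pose phi (u : S * p.-tuple R) :=
  (frob (a *: C u.1 (\row_l tnth u.2 l) - \row_l tnth u.2 l) ^+ 2)%:E.
have mphi : measurable_fun setT phi.
  apply/measurable_EFinP; apply: measurable_frob2; apply: measurable_mxB.
    apply: measurable_mxZ => i j; rewrite (ord1 i); exact: mC.
  move=> i j; rewrite (_ : (fun _ => _) = fun u : S * p.-tuple R => tnth u.2 j).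
    apply: (@measurableT_comp _ _ _ _ _ _ (fun t : p.-tuple R => tnth t j)) => //.
    exact: measurable_tnth.
  by apply/funext => u; rewrite mxE.
have rowE i : (\int[P]_w (frob (a *: C (xi (k, b, i) w) (row i (Z w)) - row i (Z w)) ^+
  2)%:E
    <= c%:E * \int[P]_w (frob (row i (Z w)) ^+ 2)%:E)%E.
  pose U w := [tuple (row i (Z w)) 0 j | j < p].
  have mU : @measurable_fun _ _ (g_sigma_algebraType (cylinders xi (past k))) _ setT U.
    by apply: measurable_tuple_of_row; exact: measurable_mx_row.
  have mUO : measurable_fun setT U by exact: (measurable_of_cylinders _ _ _ _ _ mU).
  pose UU : {RV P >-> p.-tuple R} := HB.pack U (isMeasurableFun.Build _ _ _ _ U mUO).
  have [law ind] := hxi.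
  have := @integral_indep_pair _ _ _ _ _ _ _ P nu (xi (k, b, i)) UU phi.
  rewrite /phi /= /U; under eq_integral do rewrite row_of_tuple.
  move=> ->//; last 3 first.
  - by move=> A mA; exact: law.
  - move=> A B mA mB; apply: (@indep_cylinders _ _ _ _ _ P _ xi (past k)) => //.
    by rewrite in_past ltnn.
  - by move=> z; rewrite lee_fin sqr_ge0.
  have mrow : measurable_fun setT (fun w => (frob (row i (Z w)) ^+ 2)%:E).
    by apply/measurable_EFinP; apply: measurable_frob2; exact: measurable_mx_row.
  rewrite -ge0_integralZl//; last by move=> w _; rewrite lee_fin sqr_ge0.
  apply: ge0_le_integral => //.
  - by move=> w _; apply: integral_ge0 => s _; rewrite lee_fin sqr_ge0.
  - have := @measurable_fun_fubini_tonelli_G _ _ _ _ _ nu phi mphi (fun=> _).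
    move=> mG; apply: (measurableT_comp (mG _) mUO).
    by move=> z; rewrite lee_fin sqr_ge0.
  - exact: measurable_funeM.
  - by move=> w _; rewrite row_of_tuple; exact: hc.
have mZi i : measurable_fun setT (fun w => (frob (row i (Z w)) ^+ 2)%:E).
  by apply/measurable_EFinP; apply: measurable_frob2; exact: measurable_mx_row.
under eq_integral do rewrite frob2_rows -sumEFin.
under [X in (_ <= _ * X)%E]eq_integral do rewrite frob2_rows -sumEFin.
rewrite !ge0_integral_sum//; last 3 first.
- by move=> i w _; rewrite lee_fin sqr_ge0.
- move=> i; apply/measurable_EFinP; apply: measurable_frob2; apply: measurable_mx_row.
  apply: measurable_mxB => //; apply: measurable_mxZ.
  exact: (measurable_mx_compress_rows (fun i w => xi (k, b, i) w)).
- by move=> i w _; rewrite lee_fin sqr_ge0.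
rewrite ge0_sume_distrr; last by move=> i _; apply: integral_ge0 => w _;
  rewrite lee_fin sqr_ge0.
apply: lee_sum => i _; apply: le_trans (rowE i).
rewrite le_eqVlt; apply/orP; left; apply/eqP; apply: eq_integral => w _.
congr ((frob _ ^+ 2)%:E); apply/rowP => j; rewrite !mxE; congr (_ * _ - _).
Qed.

End Step.
End Compress.

(** * Averages, deviations and gossip *)

Section Avg.
Context {R : realType} {n p : nat}.
Hypothesis n0 : (0 < n)%N.
Implicit Types X Y : 'M[R]_(n, p).

(** The orthogonal projection onto the complement of the consensus subspace. *)
Definition dev X : 'M[R]_(n, p) := X - ones n *m avg X.

Let nR : n%:R != 0 :> R. Proof. by rewrite pnatr_eq0 -lt0n. Qed.

Lemma avgE X j : avg X 0 j = n%:R^-1 * \sum_i X i j.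
Proof.
rewrite !mxE; congr (_ * _); apply: eq_bigr => i _; by rewrite !mxE mul1r.
Qed.

Lemma avgD X Y : avg (X + Y) = avg X + avg Y.
Proof. by rewrite /avg mulmxDr scalerDr. Qed.

Lemma avgZ a X : avg (a *: X) = a *: avg X.
Proof. by rewrite /avg -scalemxAr !scalerA mulrC. Qed.

Lemma avgN X : avg (- X) = - avg X.
Proof. by rewrite -scaleN1r avgZ scaleN1r. Qed.

Lemma avgB X Y : avg (X - Y) = avg X - avg Y.
Proof. by rewrite avgD avgN. Qed.

Lemma ones_mulE (v : 'rV[R]_p) i j : (ones n *m v) i j = v 0 j.
Proof. by rewrite mxE big_ord1 mxE mul1r. Qed.

Lemma avg_ones (v : 'rV[R]_p) : avg (ones n *m v) = v.
Proof.
apply/rowP => j; rewrite avgE; under eq_bigr do rewrite ones_mulE.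
by rewrite sumr_const card_ord -(mulr_natl (v 0 j)) mulrA mulVf// mul1r.
Qed.

Lemma dev_avg X : avg (dev X) = 0.
Proof. by rewrite /dev avgB avg_ones subrr. Qed.

Lemma devD X Y : dev (X + Y) = dev X + dev Y.
Proof. by rewrite /dev avgD mulmxDr opprD addrACA. Qed.

Lemma devZ a X : dev (a *: X) = a *: dev X.
Proof. by rewrite /dev avgZ scalerBr -scalemxAr. Qed.

Lemma devN X : dev (- X) = - dev X.
Proof. by rewrite -scaleN1r devZ scaleN1r. Qed.

Lemma devB X Y : dev (X - Y) = dev X - dev Y.
Proof. by rewrite devD devN. Qed.

Lemma frob_ones (v : 'rV[R]_p) : frob (ones n *m v) ^+ 2 = n%:R * frob v ^+ 2.
Proof.
rewrite !frob2E big_ord1; under eq_bigr do under eq_bigr do rewrite ones_mulE.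
by rewrite sumr_const card_ord mulr_natl.
Qed.

(** The columns of [dev X] sum to zero, so their cross terms with the constant columns of
    [ones n *m avg X] cancel. *)
Lemma frob2_pythagoras X : frob X ^+ 2 = frob (dev X) ^+ 2 + n%:R * frob (avg X) ^+ 2.
Proof.
rewrite -frob_ones.
rewrite !frob2E -sum2D exchange_big [RHS]exchange_big; apply: eq_bigr => j _.
have S : \sum_i dev X i j = 0.
  have := avgE (dev X) j; rewrite dev_avg mxE => /esym/eqP.
  by rewrite mulf_eq0 invr_eq0 (negbTE nR) => /eqP.
transitivity (\sum_i (dev X i j ^+ 2 + (ones n *m avg X) i j ^+ 2
    + (2 * avg X 0 j) * dev X i j)).
  apply: eq_bigr => i _; have -> : dev X i j = X i j - avg X 0 j
    by rewrite 2!mxE ones_mulE.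
  by rewrite ones_mulE; ring.
by rewrite big_split/= -mulr_sumr S mulr0 addr0.
Qed.

Lemma frob2_dev_le X : frob (dev X) ^+ 2 <= frob X ^+ 2.
Proof. by rewrite [leRHS]frob2_pythagoras lerDl mulr_ge0// sqr_ge0. Qed.

Lemma frob2_avg_le X : frob (avg X) ^+ 2 <= n%:R^-1 * frob X ^+ 2.
Proof.
rewrite ler_pdivlMl ?ltr0n// [leRHS]frob2_pythagoras lerDr sqr_ge0//.
Qed.

Section Weights.
Variable W : 'M[R]_n.
Hypotheses (Wrow : W *m ones n = ones n) (Wcol : (ones n)^T *m W = (ones n)^T).

Lemma avg_lap X : avg ((1%:M - W) *m X) = 0.
Proof. by rewrite /avg mulmxA mulmxBr mulmx1 Wcol subrr mul0mx scaler0. Qed.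

Lemma dev_lap X : dev ((1%:M - W) *m X) = (1%:M - W) *m X.
Proof. by rewrite /dev avg_lap mulmx0 subr0. Qed.

Lemma lap_dev X : (1%:M - W) *m X = (1%:M - W) *m dev X.
Proof.
rewrite /dev mulmxBr [_ *m (ones n *m _)]mulmxA [_ *m ones n]mulmxBl mul1mx Wrow.
by rewrite subrr mul0mx subr0.
Qed.

Lemma frob2_lap_le X :
  frob ((1%:M - W) *m X) ^+ 2 <= spectral_norm (1%:M - W) ^+ 2 * frob (dev X) ^+ 2.
Proof. rewrite lap_dev; exact: frob2_mulmx. Qed.

(** Averaging annihilates [dev X], so [W] may be replaced by the matrix whose spectral norm defines
    [rho_w W]. *)
Lemma frob2_mix_dev_le X :
  frob (W *m dev X) ^+ 2 <= rho_w W ^+ 2 * frob (dev X) ^+ 2.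
Proof.
have -> : W *m dev X = (W - n%:R^-1 *: (ones n *m (ones n)^T)) *m dev X.
  rewrite mulmxBl -scalemxAl -mulmxA scalemxAr -/(avg (dev X)) dev_avg.
  by rewrite mulmx0 subr0.
exact: frob2_mulmx.
Qed.

(* Convex combination with weights [1 - gamma], [gamma * rho_w] and
   [gamma * (1 - rho_w)], the last one carrying the perturbation. *)
Lemma frob2_gossip_le gamma X (E : 'M[R]_(n, p)) :
  0 < gamma -> gamma <= 1 -> rho_w W < 1 ->
  frob (dev X - gamma *: ((1%:M - W) *m X) + E) ^+ 2
  <= (1 - gamma * (1 - rho_w W)) * frob (dev X) ^+ 2
     + (gamma * (1 - rho_w W))^-1 * frob E ^+ 2.
Proof.
move=> g0 g1 rho1; have rho0 : 0 <= rho_w W by exact: spectral_norm_ge0.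
set rho := rho_w W in rho1 rho0 *.
(* Normalised so that the weight [gamma * rho] stands in front of it. If [rho = 0] then
   [rho^-1 = 0], but [W *m dev X] vanishes too, so [BE] still holds. *)
pose B := rho^-1 *: (W *m dev X).
have BE : rho *: B = W *m dev X.
  have [r0|r0] := eqVneq rho 0; last by rewrite scalerA mulfV// scale1r.
  rewrite r0 scale0r; apply/esym/frob_eq0/eqP; rewrite -sqrf_eq0 eq_le sqr_ge0 andbT.
  by apply: le_trans (frob2_mix_dev_le X) _; rewrite -/rho r0 expr0n mul0r.
have Ble : rho * frob B ^+ 2 <= rho * frob (dev X) ^+ 2.
  have [r0|r0] := eqVneq rho 0; first by rewrite r0 !mul0r.
  apply: ler_wpM2l => //; rewrite frob2Z exprVn ler_pdivrMl ?exprn_gt0 ?lt_def ?r0//.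
  exact: frob2_mix_dev_le.
have -> : dev X - gamma *: ((1%:M - W) *m X) + E =
    (1 - gamma) *: dev X + (gamma * rho) *: B + E.
  congr (_ + _); rewrite lap_dev mulmxBl mul1mx -scalerA BE scalerBr scalerBl scale1r.
  by rewrite opprB addrA addrAC.
have := @frob2_convex3 R n p (1 - gamma) (gamma * rho) (gamma * (1 - rho)) (dev X) B E.
move=> h; apply: le_trans (h _ _ _ _) _.
- by rewrite subr_ge0.
- by rewrite mulr_ge0// ltW.
- by rewrite mulr_gt0// subr_gt0.
- by ring.
rewrite lerD2r -lerBrDl -mulrBl.
have -> : 1 - gamma * (1 - rho) - (1 - gamma) = gamma * rho by ring.
by rewrite -!mulrA ler_wpM2l// ltW.
Qed.

End Weights.

Lemma frob2_diag_le (eta : 'I_n -> R) (h : R) X :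
  (forall i, 0 <= eta i <= h) ->
  frob (diag_mx (\row_(i < n) eta i) *m X) ^+ 2 <= h ^+ 2 * frob X ^+ 2.
Proof.
move=> he; rewrite !frob2E -sum2Z; apply: ler_sum => i _; apply: ler_sum => j _.
rewrite mul_diag_mx !mxE exprMn ler_wpM2r ?sqr_ge0//.
have /andP[e0 eh] := he i; rewrite ler_pXn2r// nnegrE//; exact: le_trans eh.
Qed.

Lemma avg_diag_ones (eta : 'I_n -> R) (v : 'rV[R]_p) :
  avg (diag_mx (\row_(i < n) eta i) *m (ones n *m v)) = (n%:R^-1 * \sum_i eta i) *: v.
Proof.
apply/rowP => j; rewrite avgE mxE -mulrA; congr (_ * _).
rewrite mulr_suml; apply: eq_bigr => i _.
by rewrite mul_diag_mx mxE ones_mulE mxE.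
Qed.

End Avg.

(** * One step of the iteration, pathwise *)

Section Grad.
Context {R : realType} {n p : nat}.

(** Fermat's rule in one variable for the restriction of [F] to the line through [x] along [v];
    [quot] identifies the two difference quotients. *)
Lemma derive_at_min (F : 'rV[R]_p -> R) (x v : 'rV[R]_p) :
  (forall y, differentiable F y) -> (forall y, F x <= F y) -> 'D_v F x = 0.
Proof.
move=> dF minF.
pose h (t : R) := F (t *: v + x).
have quot t : (fun s : R => s^-1 *: ((h \o shift t) (s *: (1 : R)) - h t)) =
    (fun s : R => s^-1 *: ((F \o shift (t *: v + x)) (s *: v) - F (t *: v + x))).
  apply/funext => s; rewrite /h /=; congr (_ *: (F _ - _)).
  by rewrite addrA -scalerDl [s *: 1]mulr1.
have dh t : derivable h t 1 by rewrite /derivable quot; exact: diff_derivable.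
have [_ hE] : is_derive (0 : R) 1 h 0.
  apply: (@derive1_at_min _ h (-1) 1) => //.
  - by rewrite in_itv/= ltrN10 ltr01.
  - by move=> t _; rewrite /h scale0r add0r.
by rewrite -hE [in RHS]/derive quot scale0r add0r.
Qed.

Lemma avg_grad_eq0 (f : 'I_n -> 'rV[R]_p -> R) (x : 'rV[R]_p) :
  (0 < n)%N -> (forall i y, differentiable (f i) y) ->
  (forall y, avg_cost f x <= avg_cost f y) -> \sum_i grad (f i) x = 0.
Proof.
move=> n0 df minf; apply/rowP => j; rewrite summxE mxE.
have minF y : (\sum_i f i) x <= (\sum_i f i) y.
  by have := minf y; rewrite /avg_cost ler_pM2l ?invr_gt0 ?ltr0n// !fct_sumE.
transitivity (\sum_i 'D_(delta_mx 0 j) (f i) x); first by apply: eq_bigr => i _;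
  rewrite mxE.
rewrite -derive_sum; last by move=> i; exact: diff_derivable.
by apply: derive_at_min => // y; exact: differentiable_sum.
Qed.
End Grad.

Section Steps.
Context {R : realType} {n p : nat}.
Hypothesis n0 : (0 < n)%N.
Implicit Types X Y E : 'M[R]_(n, p).

Section Gossip.
Variables (W : 'M[R]_n) (gamma : R).
Hypotheses (Wrow : W *m ones n = ones n) (Wcol : (ones n)^T *m W = (ones n)^T).
Hypothesis (rho1 : rho_w W < 1) (g0 : 0 < gamma) (g1 : gamma <= 1).

(** The error [E] of the compressed estimate is moved, together with [A], into the perturbation of
    an exact gossip step; the factor 2 separates the two squares. *)
Lemma gossip_dev_step X E A :
  frob (dev (X - gamma *: ((1%:M - W) *m (X + E)) + A)) ^+ 2
  <= (1 - gamma * (1 - rho_w W)) * frob (dev X) ^+ 2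
     + 2 / (gamma * (1 - rho_w W)) *
       (gamma ^+ 2 * spectral_norm (1%:M - W) ^+ 2 * frob E ^+ 2 + frob A ^+ 2).
Proof.
have s0 : 0 < 1 - rho_w W by rewrite subr_gt0.
have -> : X - gamma *: ((1%:M - W) *m (X + E)) + A =
    X - gamma *: ((1%:M - W) *m X) + (- (gamma *: ((1%:M - W) *m E)) + A).
  by rewrite mulmxDr scalerDr opprD !addrA.
rewrite devD devB devZ (dev_lap _ Wcol).
apply: le_trans (frob2_gossip_le n0 _ Wrow _ _ _ g0 g1 rho1) _.
have E2 t b : 2 / t * b = t^-1 * (2 * b) :> R by rewrite [RHS]mulrCA mulrA.
have t0 : 0 <= (gamma * (1 - rho_w W))^-1
  by rewrite invr_ge0 mulr_ge0 ?(ltW g0) ?(ltW s0).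
rewrite lerD2l E2; apply: ler_wpM2l => //.
rewrite devD; apply: le_trans (frob2D2 _ _ _ _) _; rewrite ler_wpM2l// lerD//.
  rewrite devN frobN devZ frob2Z -mulrA ler_wpM2l ?sqr_ge0//.
  apply: le_trans (frob2_dev_le n0 _) _; exact: frob2_mulmx.
exact: frob2_dev_le.
Qed.

Lemma gossip_diff_le X E A :
  frob (X - gamma *: ((1%:M - W) *m (X + E)) + A - X) ^+ 2
  <= 3 * (gamma ^+ 2 * spectral_norm (1%:M - W) ^+ 2 * frob (dev X) ^+ 2
     + gamma ^+ 2 * spectral_norm (1%:M - W) ^+ 2 * frob E ^+ 2 + frob A ^+ 2).
Proof.
have -> : X - gamma *: ((1%:M - W) *m (X + E)) + A - X =
  - (gamma *: ((1%:M - W) *m X)) + - (gamma *: ((1%:M - W) *m E)) + A.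
  by rewrite addrAC [X - _]addrC addrK mulmxDr scalerDr opprD.
apply: le_trans (frob2D3 _ _ _ _ _) _; rewrite ler_wpM2l// !frobN !frob2Z lerD2r.
rewrite -[_ * _ * frob (dev X) ^+ 2]mulrA -[_ * _ * frob E ^+ 2]mulrA.
apply: lerD; rewrite ler_wpM2l ?sqr_ge0//.
  exact: (frob2_lap_le _ Wrow).
exact: frob2_mulmx.
Qed.

End Gossip.

Lemma frob2_subZ (u v : 'rV[R]_p) (e : R) :
  frob (u - e *: v) ^+ 2 = frob u ^+ 2 - 2 * e * inner v u + e ^+ 2 * frob v ^+ 2.
Proof.
rewrite !frob2E !big_ord1 /inner !mulr_sumr -sumrB -big_split/=.
by apply: eq_bigr => j _; rewrite !mxE; ring.
Qed.

Section Grads.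
Variables (f : 'I_n -> 'rV[R]_p -> R) (mui : 'I_n -> R) (L : R) (xs : 'rV[R]_p).
Hypothesis L0 : 0 <= L.
Hypothesis fL : forall i x y, frob (grad (f i) x - grad (f i) y) <= L * frob (x - y).
Hypothesis fmu : forall i x y,
  mui i * frob (x - y) ^+ 2 <= inner (grad (f i) x - grad (f i) y) (x - y).
Hypothesis xsmin : \sum_i grad (f i) xs = 0.
Let mu := n%:R^-1 * \sum_i mui i.
Let gbar x := avg (gradF f (ones n *m x)).

Lemma gradF_lip X Y : frob (gradF f X - gradF f Y) ^+ 2 <= L ^+ 2 * frob (X - Y) ^+ 2.
Proof.
rewrite frob2_rows [X in _ <= _ * X]frob2_rows mulr_sumr ler_sum// => i _.
rewrite -exprMn ler_pXn2r ?nnegrE ?mulr_ge0 ?frob_ge0//.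
rewrite [row i (X - Y)]linearB/= -[row i (_ - gradF f Y)](_ : grad (f i) (row i X) -
  grad (f i) (row i Y) = _) ?fL//.
by apply/rowP => j; rewrite !mxE.
Qed.

Lemma gbarE x : gbar x = n%:R^-1 *: \sum_i grad (f i) x.
Proof.
apply/rowP => j; rewrite avgE mxE summxE; congr (_ * _); apply: eq_bigr => i _.
by rewrite mxE; congr (grad _ _ _ _); apply/rowP => l; rewrite mxE ones_mulE.
Qed.

Lemma gbar_min : gbar xs = 0.
Proof. by rewrite gbarE xsmin scaler0. Qed.

Lemma gbar_avg_le X :
  frob (avg (gradF f X) - gbar (avg X)) ^+ 2 <= n%:R^-1 * (L ^+ 2 * frob (dev X) ^+ 2).
Proof.
rewrite -avgB; apply: le_trans (frob2_avg_le n0 _) _.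
by rewrite ler_wpM2l ?invr_ge0// gradF_lip.
Qed.

Lemma gbar_lip x : frob (gbar x) ^+ 2 <= L ^+ 2 * frob (x - xs) ^+ 2.
Proof.
rewrite -[gbar x]subr0 -gbar_min -avgB.
apply: le_trans (frob2_avg_le n0 _) _.
rewrite ler_pdivrMl ?ltr0n//; apply: le_trans (gradF_lip _ _) _.
by rewrite -mulmxBr frob_ones// mulrCA.
Qed.

Lemma gbar_mono x : mu * frob (x - xs) ^+ 2 <= inner (gbar x) (x - xs).
Proof.
have -> : inner (gbar x) (x - xs) =
    n%:R^-1 * \sum_i inner (grad (f i) x - grad (f i) xs) (x - xs).
  rewrite -[gbar x]subr0 -gbar_min !gbarE -scalerBr -sumrB /inner exchange_big/=.
  rewrite mulr_sumr; apply: eq_bigr => j _.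
  by rewrite mxE summxE -mulrA mulr_suml.
by rewrite -mulrA ler_wpM2l ?invr_ge0// mulr_suml ler_sum.
Qed.

(* The step is so small that no co-coercivity of the gradient is needed:
   [e ^ 2 * L ^ 2] is absorbed by half of the gain [e * mu] of monotonicity. *)
Lemma gradient_descent_le (e : R) x : 0 <= e -> e * L ^+ 2 <= mu / 2 ->
  frob (x - xs - e *: gbar x) ^+ 2 <= (1 - 3 / 2 * (e * mu)) * frob (x - xs) ^+ 2.
Proof.
move=> e0 eL; rewrite frob2_subZ.
have h1 := gbar_mono x; have h2 := gbar_lip x.
set a := frob (x - xs) ^+ 2 in h1 h2 *.
have a0 : 0 <= a by exact: sqr_ge0.
have h3 : 2 * e * (mu * a) <= 2 * e * inner (gbar x) (x - xs).
  by rewrite ler_wpM2l// mulr_ge0.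
have h4 : e ^+ 2 * frob (gbar x) ^+ 2 <= e ^+ 2 * (L ^+ 2 * a).
  by rewrite ler_wpM2l// sqr_ge0.
have h5 : e * a * (e * L ^+ 2) <= e * a * (mu / 2).
  by rewrite ler_wpM2l// mulr_ge0.
nra.
Qed.

(** The mean of [Y] is the average gradient at the scattered points. Replacing it by the average
    gradient at the mean point costs the consensus error, and the latter vanishes at [xs], which
    gives the optimality error. *)
Lemma tracker_norm_le X Y : avg Y = avg (gradF f X) ->
  frob Y ^+ 2 <= frob (dev Y) ^+ 2 + 2 * n%:R * L ^+ 2 * frob (avg X - xs) ^+ 2
                 + 2 * L ^+ 2 * frob (dev X) ^+ 2.
Proof.
move=> Ya; rewrite (frob2_pythagoras n0 Y) -addrA lerD2l Ya.
rewrite -[avg (gradF f X)](subrK (gbar (avg X))).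
have nR : 0 < n%:R :> R by rewrite ltr0n.
apply: le_trans (ler_wpM2l (ltW nR) (frob2D2 _ _ _ _)) _.
have h1 := gbar_avg_le X; have h2 := gbar_lip (avg X).
apply: le_trans (ler_wpM2l (ltW nR) (ler_wpM2l (ler0n _ 2) (lerD h1 h2))) _.
rewrite le_eqVlt; apply/orP; left; apply/eqP; field.
by rewrite gt_eqF.
Qed.

Section Optim.
Variables (eta : 'I_n -> R) (h : R).
Hypothesis etah : forall i, 0 <= eta i <= h.
Let etabar := n%:R^-1 * \sum_i eta i.
Let D := diag_mx (\row_(i < n) eta i).

(** With unequal step-sizes, [D *m Y] is split along the mean and the deviation of [Y]: the mean
    part averages to a step of size [etabar], and the deviation joins the gradient mismatch as a
    perturbation. *)
Lemma optimality_step X Y A :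
  0 < etabar -> 0 < mu -> etabar * L ^+ 2 <= mu / 2 -> etabar * mu <= 2^-1 ->
  avg Y = avg (gradF f X) -> avg A = 0 ->
  frob (avg (X - A - D *m Y) - xs) ^+ 2 <=
  (1 - etabar * mu) * frob (avg X - xs) ^+ 2
  + 4 / (etabar * mu) * (n%:R^-1 * (etabar ^+ 2 * L ^+ 2 * frob (dev X) ^+ 2
     + h ^+ 2 * frob (dev Y) ^+ 2)).
Proof.
move=> e0 mu0 eL emu Ya A0; rewrite !avgB A0 subr0.
have -> : avg (D *m Y) = etabar *: avg Y + avg (D *m dev Y).
  by rewrite -avg_diag_ones -avgD -mulmxDr addrC subrK.
rewrite Ya; set x := avg X.
have -> : x - (etabar *: avg (gradF f X) + avg (D *m dev Y)) - xs =
  (x - xs - etabar *: gbar x) +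
   - (etabar *: (avg (gradF f X) - gbar x) + avg (D *m dev Y)).
  rewrite scalerBr; apply/rowP => j; rewrite !mxE; ring.
set t := etabar * mu in emu *.
have t0 : 0 < t by exact: mulr_gt0.
(* The perturbation gets weight [t / 2]: since [1 - 3 / 2 * t <= (1 - t / 2) * (1 - t)], dividing
   the descent factor by [1 - t / 2] leaves at most [1 - t]. *)
have t20 : 0 < t / 2 by rewrite divr_gt0.
have t21 : t / 2 < 1 by lra.
apply: le_trans (frob2_convex2 _ _ _ _ _ t20 t21) _.
rewrite frobN invf_div; apply: lerD.
  rewrite ler_pdivrMl ?subr_gt0//.
  apply: le_trans (gradient_descent_le _ _ (ltW e0) eL) _; rewrite -/t.
  rewrite [leRHS]mulrA ler_wpM2r ?sqr_ge0//; nra.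
have -> : 4 / t = 2 / t * 2 by field; rewrite gt_eqF.
have t2 : 0 <= 2 / t by rewrite divr_ge0 ?(ltW t0).
rewrite -mulrA; apply: ler_wpM2l => //.
apply: le_trans (frob2D2 _ _ _ _) _; rewrite ler_wpM2l// mulrDr; apply: lerD.
  rewrite frob2Z.
  rewrite [leRHS](_ : _ = etabar ^+ 2 * (n%:R^-1 * (L ^+ 2 * frob (dev X) ^+ 2)));
    last by ring.
  by rewrite ler_wpM2l ?sqr_ge0//; exact: gbar_avg_le.
apply: le_trans (frob2_avg_le n0 _) _; rewrite ler_wpM2l ?invr_ge0//.
exact: frob2_diag_le.
Qed.

End Optim.
End Grads.
End Steps.

(** With [q] the compression of [x - y], the estimate [y + q] becomes [x] plus the compression
    residual. *)
Lemma addr_residual (V : zmodType) (x y q : V) : x + (q - (x - y)) = y + q.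
Proof. by rewrite opprB addrCA [x + _]addrC subrK addrC. Qed.

(** * Pathwise bounds on the five errors *)

Section Pointwise.
Context {R : realType} {n p : nat}.
Hypothesis n0 : (0 < n)%N.
Variables (W : 'M[R]_n) (gamma : R).
Hypotheses (Wrow : W *m ones n = ones n) (Wcol : (ones n)^T *m W = (ones n)^T).
Hypothesis (rho1 : rho_w W < 1) (g0 : 0 < gamma) (g1 : gamma <= 1).
Variables (f : 'I_n -> 'rV[R]_p -> R) (mui : 'I_n -> R) (L : R) (xs : 'rV[R]_p).
Hypothesis L0 : 0 <= L.
Hypothesis fL : forall i x y, frob (grad (f i) x - grad (f i) y) <= L * frob (x - y).
Hypothesis fmu : forall i x y,
  mui i * frob (x - y) ^+ 2 <= inner (grad (f i) x - grad (f i) y) (x - y).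
Hypothesis xsmin : \sum_i grad (f i) xs = 0.
Variables (eta : 'I_n -> R) (h delta alpha : R).
Hypothesis etah : forall i, 0 <= eta i <= h.
Hypothesis (d0 : 0 < delta) (d1 : delta <= 1).
Variables (cx cy : 'I_n -> 'rV[R]_p -> 'rV[R]_p) (z : @state R n p).
Let mu := n%:R^-1 * \sum_i mui i.
Let eb := n%:R^-1 * \sum_i eta i.
Let lam := spectral_norm (1%:M - W) ^+ 2.
Let s := 1 - rho_w W.
Let X := stX z.
Let Y := stY z.
Let Zx := stX z - stHx z.
Let Zy := stY z - stHy z.
Let Qx := \matrix_(i < n) cx i (row i Zx).
Let Qy := \matrix_(i < n) cy i (row i Zy).
Let z' := cgt_step W f eta gamma alpha alpha cx cy z.
Let ex := frob (1 *: Qx - Zx) ^+ 2.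
Let ey := frob (1 *: Qy - Zy) ^+ 2.
Let ux := frob (alpha *: Qx - Zx) ^+ 2.
Let uy := frob (alpha *: Qy - Zy) ^+ 2.
Let a := frob (avg X - xs) ^+ 2.
Let c := frob (dev X) ^+ 2.
Let g := frob (dev Y) ^+ 2.
(** [Ny] bounds the squared norm of [Y], and [3 * V] the squared displacement of [X]; the summands
    of [V] stem from gossip, compression and the gradient step. *)
Let Ny := g + 2 * n%:R * L ^+ 2 * a + 2 * L ^+ 2 * c.
Let V := gamma ^+ 2 * lam * c + gamma ^+ 2 * lam * ex + h ^+ 2 * Ny.
Hypothesis Ya : avg Y = avg (gradF f X).

Let XE : stX z' = X - gamma *: ((1%:M - W) *m (X + (1 *: Qx - Zx)))
   + - (diag_mx (\row_(i < n) eta i) *m Y).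
Proof.
rewrite /z' /Qx /Zx /X /Y; case: z => X1 H1 Y1 H2 /=.
by rewrite scale1r addr_residual.
Qed.

Let YE : stY z' = Y - gamma *: ((1%:M - W) *m (Y + (1 *: Qy - Zy)))
   + (gradF f (stX z') - gradF f X).
Proof.
rewrite [in LHS]/z' /Qy /Zy /X /Y /z'; case: z => X1 H1 Y1 H2 /=.
by rewrite scale1r addr_residual -addrA.
Qed.

(** The reference state moves by [alpha *: Qx], so the new distance is the scaled residual shifted
    by the displacement of [X]; for [alpha = r^-1] this is the contracting residual. *)
Let HxE : stX z' - stHx z' = - (alpha *: Qx - Zx) + (stX z' - X).
Proof.
have -> : stHx z' = stHx z + alpha *: Qx.
  rewrite /z' /Qx /Zx; case: z => X1 H1 Y1 H2 /=.
  by rewrite scalerDr addrA -scalerDl subrK scale1r.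
rewrite /Zx /X; move: (stX z') (stHx z) (alpha *: Qx) (stX z) => A B D F.
by apply/matrixP => i j; rewrite !mxE; ring.
Qed.

Let HyE : stY z' - stHy z' = - (alpha *: Qy - Zy) + (stY z' - Y).
Proof.
have -> : stHy z' = stHy z + alpha *: Qy.
  rewrite /z' /Qy /Zy; case: z => X1 H1 Y1 H2 /=.
  by rewrite scalerDr addrA -scalerDl subrK scale1r.
rewrite /Zy /Y; move: (stY z') (stHy z) (alpha *: Qy) (stY z) => A B D F.
by apply/matrixP => i j; rewrite !mxE; ring.
Qed.

Let Nyle : frob Y ^+ 2 <= Ny.
Proof. exact: (@tracker_norm_le _ _ _ n0 f L xs L0 fL xsmin X Y Ya). Qed.

Let DYle : frob (- (diag_mx (\row_(i < n) eta i) *m Y)) ^+ 2 <= h ^+ 2 * Ny.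
Proof.
rewrite frobN; apply: le_trans (frob2_diag_le _ _ _ etah) _.
by rewrite ler_wpM2l// sqr_ge0.
Qed.

Let Vle : frob (stX z' - X) ^+ 2 <= 3 * V.
Proof.
rewrite XE; apply: le_trans (gossip_diff_le _ _ Wrow _ _ _) _.
by rewrite ler_wpM2l// lerD2l.
Qed.

Let s0 : 0 < s. Proof. by rewrite subr_gt0. Qed.

Let t0 : 0 <= 2 / (gamma * s).
Proof. by rewrite divr_ge0// mulr_ge0 ?ltW. Qed.

(** Gossip has zero average because the columns of [W] sum to one, so [avg Y] changes exactly by the
    average gradient increment. *)
Lemma tracking_invariant : avg (stY z') = avg (gradF f (stX z')).
Proof.
rewrite YE avgD !avgB avgZ (avg_lap _ Wcol) scaler0 subr0 Ya.
by rewrite addrC subrK.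
Qed.

Lemma optimality_row :
  0 < eb -> 0 < mu -> eb * L ^+ 2 <= mu / 2 -> eb * mu <= 2^-1 ->
  frob (avg (stX z') - xs) ^+ 2 <= (1 - eb * mu) * a
  + 4 / (eb * mu) * (n%:R^-1 * (eb ^+ 2 * L ^+ 2 * c + h ^+ 2 * g)).
Proof.
move=> e0 m0 eL emu; rewrite XE.
apply: (@optimality_step _ _ _ n0 f mui L xs L0 fL fmu xsmin eta h etah) => //.
by rewrite avgZ (avg_lap _ Wcol) scaler0.
Qed.

Lemma consensus_row :
  frob (dev (stX z')) ^+ 2 <=
  (1 - gamma * s) * c + 2 / (gamma * s) * (gamma ^+ 2 * lam * ex + h ^+ 2 * Ny).
Proof.
rewrite XE; apply: le_trans (gossip_dev_step n0 _ _ Wrow Wcol rho1 g0 g1 _ _ _) _.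
by rewrite lerD2l; apply: ler_wpM2l => //; rewrite lerD2l.
Qed.

Let gradVle : frob (gradF f (stX z') - gradF f X) ^+ 2 <= L ^+ 2 * (3 * V).
Proof.
apply: le_trans (gradF_lip f L L0 fL _ _) _.
by rewrite ler_wpM2l// sqr_ge0.
Qed.

Lemma tracking_row :
  frob (dev (stY z')) ^+ 2 <=
  (1 - gamma * s) * g + 2 / (gamma * s) * (gamma ^+ 2 * lam * ey + L ^+ 2 * (3 * V)).
Proof.
rewrite YE; apply: le_trans (gossip_dev_step n0 _ _ Wrow Wcol rho1 g0 g1 _ _ _) _.
by rewrite lerD2l; apply: ler_wpM2l => //; rewrite lerD2l.
Qed.

Let d20 : 0 < delta / 2. Proof. by rewrite divr_gt0. Qed.
Let d21 : delta / 2 < 1. Proof. by move: d1; lra. Qed.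

(** The weight [delta / 2] is chosen so that, after [ux] is averaged, the factor is [(1 - delta) /
    (1 - delta / 2) = 1 - delta / (2 - delta)]; the same quotient appears in the bound on
    [gamma]. *)
Lemma compression_x_row :
  frob (stX z' - stHx z') ^+ 2 <=
  (1 - delta / 2)^-1 * ux + (delta / 2)^-1 * (3 * V).
Proof.
rewrite HxE; apply: le_trans (frob2_convex2 _ _ _ _ _ d20 d21) _.
by rewrite frobN lerD2l ler_wpM2l// invr_ge0 ltW.
Qed.

Lemma compression_y_row :
  frob (stY z' - stHy z') ^+ 2 <=
  (1 - delta / 2)^-1 * uy + (delta / 2)^-1 *
   (3 * (gamma ^+ 2 * lam * g + gamma ^+ 2 * lam * ey + L ^+ 2 * (3 * V))).
Proof.
rewrite HyE; apply: le_trans (frob2_convex2 _ _ _ _ _ d20 d21) _.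
rewrite frobN lerD2l ler_wpM2l// ?invr_ge0 ?(ltW d20)//.
rewrite YE; apply: le_trans (gossip_diff_le _ _ Wrow _ _ _) _.
by rewrite ler_wpM2l// lerD2l.
Qed.

End Pointwise.

(** * The linear system of error bounds *)

Section Arith.
Context {R : realType}.
Variables (mu L lam s gamma h eb M Cc delta nn kappa m ks G N nu : R).
Hypotheses (mu0 : 0 < mu) (muL : mu <= L) (lam0 : 0 <= lam) (s0 : 0 < s) (s1 : s <= 1).
Hypotheses (g0 : 0 < gamma) (g1 : gamma <= 1) (h0 : 0 < h) (M0 : 0 < M).
Hypotheses (Mh : M * h <= eb) (ebh : eb <= h) (C0 : 0 <= Cc).
Hypotheses (d0 : 0 < delta) (d1 : delta <= 1) (nn0 : 0 < nn).
Hypothesis kappaE : kappa = L / mu.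
Hypothesis mE : m = 6 / delta *
      ((72 * kappa ^+ 2 / M ^+ 2 + lam + 3) *
         (432 * Cc * lam ^+ 2 / s ^+ 4 + 48 * Cc * lam / s ^+ 2)
       + (3 * lam + 6) * (12 * Cc * lam / s ^+ 2)
       + 4 * Cc * lam)
    + M / (2 * kappa).
Hypothesis gm : gamma <= delta / (m * (2 - delta)).
Hypothesis hs : h <= s ^+ 2
      / Num.sqrt (12 * ((24 * kappa ^+ 2 / M ^+ 2 + 1) * (4 * s ^+ 2 + 36 * lam)
                        + 2 * s ^+ 2))
      * (gamma / L).
(* [nu] is the step-size normalised by [gamma / L]; [s ^ 2 * N] is the bracket
   in the step-size bound, which thus reads [12 * nu ^ 2 * N <= s ^ 2]. *)
Hypothesis ksE : ks = kappa ^+ 2 / M ^+ 2.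
Hypothesis GE : G = 4 + 36 * lam / s ^+ 2.
Hypothesis NE : N = (24 * ks + 1) * G + 2.
Hypothesis nuE : nu = h * L / gamma.

Let L0 : 0 < L. Proof. exact: lt_le_trans muL. Qed.
Let kappa1 : 1 <= kappa. Proof. by rewrite kappaE ler_pdivlMr ?mul1r. Qed.
Let kappa0 : 0 < kappa. Proof. exact: lt_le_trans kappa1. Qed.
Let M1 : M <= 1. Proof. by rewrite -(ler_pM2r h0) mul1r (le_trans Mh). Qed.
Let sM1 : s * M <= 1. Proof. by rewrite mulr_ile1 ?(ltW s0) ?(ltW M0). Qed.
Let ks1 : 1 <= ks.
Proof.
rewrite ksE ler_pdivlMr ?exprn_gt0// mul1r ler_pXn2r ?nnegrE ?(ltW M0) ?(ltW kappa0)//.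
exact: le_trans kappa1.
Qed.
Let G4 : 4 <= G.
Proof. by rewrite GE lerDl divr_ge0 ?sqr_ge0// mulr_ge0. Qed.
Let nu0 : 0 < nu. Proof. by rewrite nuE !divr_gt0 ?mulr_gt0. Qed.
Let s20 : 0 < s ^+ 2. Proof. by rewrite exprn_gt0. Qed.
Let M20 : 0 < M ^+ 2. Proof. by rewrite exprn_gt0. Qed.
Let kE : kappa ^+ 2 = ks * M ^+ 2. Proof. by rewrite ksE mulfVK ?gt_eqF. Qed.
Let N0 : 0 < N. Proof. by rewrite NE; move: ks1 G4; nra. Qed.

Let nuN : 12 * (nu ^+ 2 * N) <= s ^+ 2.
Proof.
move: hs; set B := 12 * _ => hs'.
have BE : B = 12 * (s ^+ 2 * N).
  by rewrite /B NE GE ksE; field; rewrite ?gt_eqF.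
have B0 : 0 < B by rewrite BE !mulr_gt0.
have S0 : 0 < Num.sqrt B by rewrite sqrtr_gt0.
have hB : nu * Num.sqrt B <= s ^+ 2.
  rewrite -ler_pdivlMr// nuE ler_pdivrMr// -ler_pdivlMr//.
  by rewrite -mulrA.
have : (nu * Num.sqrt B) ^+ 2 <= (s ^+ 2) ^+ 2.
  by rewrite ler_pXn2r// nnegrE ?sqr_ge0// mulr_ge0 ?ltW.
have SE : Num.sqrt B ^+ 2 = 12 * (s ^+ 2 * N) by rewrite -BE; exact: sqr_sqrtr (ltW B0).
rewrite exprMn SE => hh; rewrite -(ler_pM2l s20) -expr2; apply: le_trans hh.
by rewrite le_eqVlt; apply/orP; left; apply/eqP; ring.
Qed.

(** From [G >= 4] comes [N >= 96 * ks], so [nuN] gives [1152 * nu ^ 2 * ks <= s ^ 2], and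
    [33 ^ 2 = 1089]. *)
Let nuk : 33 * (nu * kappa) <= s * M.
Proof.
rewrite -(@ler_pXn2r _ 2)// ?nnegrE ?mulr_ge0 ?(ltW nu0) ?(ltW kappa0) ?(ltW s0) ?(ltW
  M0)//.
have h1 : nu ^+ 2 * (96 * ks) <= nu ^+ 2 * N.
  by rewrite ler_wpM2l ?sqr_ge0// NE; move: ks1 G4; nra.
have -> : (33 * (nu * kappa)) ^+ 2 = 33 ^+ 2 * (nu ^+ 2 * ks) * M ^+ 2.
  by rewrite !exprMn kE; ring.
rewrite exprMn ler_pM2r//; move: nuN s20; lra.
Qed.

Let nu33 : 33 * nu <= s * M. Proof. by apply: le_trans nuk; move: nu0 kappa1; nra. Qed.

Let hE : h = nu * gamma / L. Proof. by rewrite nuE; field; rewrite !gt_eqF. Qed.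
Let LE : L = kappa * mu. Proof. by rewrite kappaE mulfVK// gt_eqF. Qed.

Lemma step_size_small : eb * L ^+ 2 <= mu / 2.
Proof.
apply: le_trans (_ : h * L ^+ 2 <= _); first by rewrite ler_wpM2r// sqr_ge0.
have -> : h * L ^+ 2 = nu * gamma * kappa * mu.
  by rewrite hE LE; field; rewrite !gt_eqF.
rewrite mulrC ler_pM2l//.
have : nu * gamma * kappa <= nu * kappa by rewrite mulrAC ler_piMr// mulr_ge0 ?ltW.
have := sM1.
move: nuk; lra.
Qed.

Lemma step_size_small_mu : eb * mu <= 2^-1.
Proof.
have : eb * mu <= h * L by rewrite ler_pM ?(ltW mu0)// (le_trans _ Mh)// mulr_ge0 ?ltW.
have -> : h * L = nu * gamma by rewrite hE mulfVK ?gt_eqF.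
have : nu * gamma <= nu by rewrite ler_piMr// ltW.
have := sM1.
move: nu33; lra.
Qed.

Lemma rate_drop : M * h * mu / 2 = gamma * (M * nu / (2 * kappa)).
Proof. by rewrite hE LE; field; rewrite !gt_eqF. Qed.

(** Since [33 * nu <= s * M], [M <= 1] and [kappa >= 1], the left side is even at most [s / 66]. *)
Lemma rate_drop_le : M * nu / (2 * kappa) <= s / 60.
Proof.
rewrite ler_pdivrMr ?mulr_gt0//.
have : M * nu <= nu by rewrite ler_piMl// ltW.
have : s * M <= s by rewrite ler_piMr// ltW.
have : s / 60 * (2 * kappa) >= s / 60 * 2.
  by rewrite ler_pM2l ?divr_gt0//; move: kappa1; lra.
move: nu33 s0; lra.
Qed.

Lemma rate_bounds : 0 < 1 - M * h * mu / 2 /\ 1 - M * h * mu / 2 < 1.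
Proof.
have p : 0 < M * h * mu by rewrite !mulr_gt0.
have : gamma * (M * nu / (2 * kappa)) <= 1 * (s / 60).
  by rewrite ler_pM ?(ltW g0) ?rate_drop_le// divr_ge0// mulr_ge0 ?ltW.
by rewrite -rate_drop; move: s1; split; lra.
Qed.

(* The natural choice is [H = s ^ 2 / (12 * lam * Cc)], whose inverse appears in
   [m].  When [lam * Cc = 0] the compression errors do not feed back into the
   other errors, and any large enough [H] works because [nu < 1] leaves a strict
   gap between the rate and the contraction of the compression errors. *)
Lemma compression_weight : exists2 H : R, 0 < H &
  lam * Cc * H <= s ^+ 2 / 12 /\
  6 / delta * gamma ^+ 2 *
     (lam * G + lam * Cc * H + 3 * (lam + lam * Cc * H + nu ^+ 2 * N))
  <= (delta / (2 - delta) - gamma * (M * nu / (2 * kappa))) * H.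
Proof.
set d := M * nu / _.
have nu1 : nu < 1.
  have := sM1.
  by move: nu33; lra.
have dlt : d < M / (2 * kappa) by rewrite ltr_pM2r ?invr_gt0 ?mulr_gt0// gtr_pMr.
have dl2 : 0 < 2 - delta by move: d1; lra.
(* The inverse of the natural [H]. Expanding [G] and [N], [K2 * G] gives the terms with 432 and 48
   in [m], and [lam * G + 3 * lam + 3 * N] equals [(72 * ks + lam + 3) * G + 3 * lam + 6]; thus [B]
   is the bracket in [m]. *)
pose K2 := 12 * Cc * lam / s ^+ 2.
have K20 : 0 <= K2 by rewrite divr_ge0 ?sqr_ge0// !mulr_ge0.
pose B := K2 * (lam * G + 3 * lam + 3 * N) + 4 * Cc * lam.
have lG0 : 0 <= lam * G by rewrite mulr_ge0// (le_trans _ G4).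
have nN0 : 0 <= nu ^+ 2 * N by rewrite mulr_ge0 ?sqr_ge0// ltW.
have B0 : 0 <= B.
  apply: addr_ge0; last by rewrite !mulr_ge0.
  by apply: mulr_ge0 => //; move: lG0 lam0 N0; lra.
have mB : m = 6 / delta * B + M / (2 * kappa).
  rewrite mE /B /K2 NE GE ksE; field.
  by rewrite !gt_eqF.
have m0 : 0 < m by rewrite mB ltr_wpDl// ?mulr_ge0 ?invr_ge0 ?(ltW d0)// divr_gt0//
  mulr_gt0.
have gm' : gamma * m <= delta / (2 - delta).
  by move: gm; rewrite invfM mulrCA mulrC -ler_pdivlMr// mulrC.
have h6 : 0 < 6 / delta by rewrite divr_gt0.
(* The summand [M / (2 * kappa)] of [m] pays for the rate drop [d], which is [nu] times it; what
   remains is the strict surplus used when [lam * Cc = 0]. *)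
have gap : gamma * (6 / delta * B) + gamma * (M / (2 * kappa) - d)
    <= delta / (2 - delta) - gamma * d.
  by move: gm'; rewrite mB; lra.
have NN : nu ^+ 2 * N <= N by rewrite ler_piMl ?(ltW N0)// exprn_ile1 ?ltW.
have gg : gamma ^+ 2 <= gamma by rewrite expr2 ler_piMr// ltW.
have [LC0|LC0] := eqVneq (lam * Cc) 0.
  pose w := delta / (2 - delta) - gamma * d.
  have w0 : 0 < w.
    apply: lt_le_trans gap.
    have g1' : 0 <= gamma * (6 / delta * B)
      by rewrite mulr_ge0 ?(ltW g0)// mulr_ge0 ?(ltW h6).
    have g2' : 0 < gamma * (M / (2 * kappa) - d) by rewrite mulr_gt0// subr_gt0.
    lra.
  pose Q := 6 / delta * gamma ^+ 2 * (lam * G + 3 * (lam + nu ^+ 2 * N)).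
  have Q0 : 0 <= Q.
    rewrite mulr_ge0//; first by rewrite mulr_ge0 ?(ltW h6) ?sqr_ge0.
    by move: lG0 nN0 lam0; lra.
  exists (Q / w + 1); first by rewrite ltr_wpDl// divr_ge0// ltW.
  rewrite LC0 !mul0r !addr0 divr_ge0 ?sqr_ge0//; split => //.
  by rewrite -/w -/Q mulrDr mulr1 mulrC mulfVK ?gt_eqF// lerDl ltW.
have LCp : 0 < lam * Cc by rewrite lt_def LC0 mulr_ge0.
pose H := s ^+ 2 / (12 * (lam * Cc)).
have H0 : 0 < H by rewrite divr_gt0// mulr_gt0.
have LCH : lam * Cc * H = s ^+ 2 / 12 by rewrite /H; field; move: LC0;
  rewrite mulf_eq0 negb_or => /andP[-> ->].
exists H => //; split; first by rewrite LCH.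
(* Enlarging [nu ^ 2 * N] to [N] and [gamma ^ 2] to [gamma] makes the requirement linear in [gamma],
   as the hypothesis [gm] is. *)
apply: le_trans (_ : gamma * (6 / delta * B) * H <= _); last first.
  rewrite ler_pM2r//; apply: le_trans gap; rewrite lerDl mulr_ge0 ?(ltW g0)//.
  by rewrite subr_ge0 ltW.
have BH : B * H = lam * G + 3 * lam + 3 * N + 4 * (lam * Cc * H).
  have K2H : K2 * H = 1.
    move: LC0; rewrite mulf_eq0 negb_or => /andP[l1 l2].
    by rewrite /K2 /H; field; rewrite ?l1 ?l2 ?gt_eqF.
  by rewrite /B mulrDl mulrAC K2H mul1r; ring.
rewrite (_ : gamma * (6 / delta * B) * H = 6 / delta * gamma * (B * H)); last by ring.
rewrite BH; apply: ler_pM.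
- by rewrite mulr_ge0 ?(ltW h6) ?sqr_ge0.
- have := mulr_gt0 LCp H0; move: lG0 nN0 lam0; lra.
- by rewrite ler_pM2l.
- move: NN; lra.
Qed.

(* Weights of the optimality, consensus, tracking and the two compression errors:
   [(12 * ks * G / nn, 1, L ^ 2 * G, H, L ^ 2 * H)]. *)
Lemma error_weights : exists a c g kx ky : R,
  let q := 1 - M * h * mu / 2 in
  let Ny := g + 2 * nn * L ^+ 2 * a + 2 * L ^+ 2 * c in
  let V := gamma ^+ 2 * lam * c + gamma ^+ 2 * lam * (Cc * kx) + h ^+ 2 * Ny in
  [/\ 0 < a, 0 < c, 0 < g, 0 < kx & 0 < ky] /\
  [/\ (1 - eb * mu) * a + 4 / (eb * mu) * (nn^-1 * (eb ^+ 2 * L ^+ 2 * c + h ^+ 2 * g))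
    <= q * a,
      (1 - gamma * s) * c + 2 / (gamma * s) * (gamma ^+ 2 * lam * (Cc * kx) + h ^+ 2 *
        Ny) <= q * c,
      (1 - gamma * s) * g + 2 / (gamma * s) * (gamma ^+ 2 * lam * (Cc * ky) + L ^+ 2 *
        (3 * V)) <= q * g,
      (1 - delta / 2)^-1 * ((1 - delta) * kx) + (delta / 2)^-1 * (3 * V) <= q * kx &
      (1 - delta / 2)^-1 * ((1 - delta) * ky) + (delta / 2)^-1 *
        (3 * (gamma ^+ 2 * lam * g + gamma ^+ 2 * lam * (Cc * ky) + L ^+ 2 * (3 * V)))
          <= q * ky].
Proof.
have [H H0 [LCH gap]] := compression_weight.
have G0 : 0 < G by apply: lt_le_trans G4.
have L20 : 0 < L ^+ 2 by rewrite exprn_gt0.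
have ks0 : 0 < ks by apply: lt_le_trans ks1.
exists (12 * ks * G / nn), 1, (L ^+ 2 * G), H, (L ^+ 2 * H) => q Ny V.
split.
  by split => //; [rewrite divr_gt0// !mulr_gt0|exact: mulr_gt0|exact: mulr_gt0].
have NyE : Ny = L ^+ 2 * N by rewrite /Ny NE; field; rewrite gt_eqF.
have hN : h ^+ 2 * Ny = gamma ^+ 2 * (nu ^+ 2 * N).
  by rewrite NyE hE; field; rewrite gt_eqF.
have VE : V = gamma ^+ 2 * (lam + lam * Cc * H + nu ^+ 2 * N).
  by rewrite /V hN; ring.
have qE : q = 1 - gamma * (M * nu / (2 * kappa)) by rewrite /q rate_drop.
have dle := rate_drop_le; have [d dE] : exists d, M * nu / (2 * kappa) = d by exists (M
  * nu / (2 * kappa)).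
rewrite dE in qE dle gap.
have eb0 : 0 < eb by apply: lt_le_trans Mh; rewrite mulr_gt0.
have Z0 : 0 <= lam * Cc * H by rewrite !mulr_ge0 ?(ltW H0).
have [Z ZE] : exists Z, lam * Cc * H = Z by exists (lam * Cc * H).
rewrite ZE in Z0 LCH gap VE.
have gs : 0 < gamma * s by rewrite mulr_gt0.
have dl : (1 - delta / 2)^-1 * (1 - delta) = 1 - delta / (2 - delta).
  by field; rewrite !gt_eqF//; move: d1; lra.
have d2 : (delta / 2)^-1 * 3 = 6 / delta by field; rewrite gt_eqF.
split.
(* Up to the factor [mu / (nn * eb)], the weight 12 and [M * h <= eb] leave a gain of at least
   [6 * G * eb ^ 2 * ks]; the consensus and tracking terms cost at most one and four times
   [G * eb ^ 2 * ks]. *)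
- have e0 : 0 < eb * mu by rewrite mulr_gt0.
  rewrite /q -subr_ge0.
  have -> : (1 - M * h * mu / 2) * (12 * ks * G / nn) - ((1 - eb * mu) * (12 * ks * G /
    nn) +
     4 / (eb * mu) * (nn^-1 * (eb ^+ 2 * L ^+ 2 * 1 + h ^+ 2 * (L ^+ 2 * G)))) =
     nn^-1 * (mu / eb) * ((eb - M * h / 2) * eb * (12 * ks * G) - 4 * (eb ^+ 2 * kappa
       ^+ 2 + h ^+ 2 * kappa ^+ 2 * G)).
    by rewrite LE; field; rewrite !gt_eqF.
  apply: mulr_ge0; first by rewrite mulr_ge0 ?invr_ge0 ?divr_ge0 ?ltW.
  rewrite kE subr_ge0.
  have h1 : h ^+ 2 * (ks * M ^+ 2) <= eb ^+ 2 * ks.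
    rewrite mulrCA [leRHS]mulrC ler_pM2l// -exprMn ler_pXn2r ?nnegrE 1?mulrC//.
      by rewrite mulr_ge0 ?ltW.
    by rewrite ltW.
  have h2 : eb ^+ 2 * (ks * M ^+ 2) <= eb ^+ 2 * ks.
    by rewrite ler_wpM2l ?sqr_ge0// ler_piMr ?(ltW ks0)// exprn_ile1 ?(ltW M0).
  have h3 : eb / 2 * eb <= (eb - M * h / 2) * eb by rewrite ler_pM2r//; move: Mh; lra.
  have h4 := ler_wpM2r (ltW G0) h1.
  have kG0 : 0 <= 12 * ks * G by rewrite !mulr_ge0 ?ltW.
  have h5 := ler_wpM2r kG0 h3.
  have h6 : 4 * (eb ^+ 2 * ks) <= G * (eb ^+ 2 * ks).
    by rewrite ler_wpM2r// mulr_ge0 ?sqr_ge0 ?ltW.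
  have h7 : 0 <= eb ^+ 2 * ks by rewrite mulr_ge0 ?sqr_ge0 ?(ltW N0) ?(ltW ks0).
  apply: le_trans h5; rewrite (_ : eb / 2 * eb * (12 * ks * G) = 6 * (G * (eb ^+ 2 *
    ks))); last by field.
  lra.
(* Consensus row, per unit of [gamma]: [Z] and [nu ^ 2 * N] are each at most [s ^ 2 / 12], so the
   coupling takes at most [s / 3] out of [s - d]. *)
- rewrite hN qE !mulr1 -lerBrDl.
  rewrite (_ : 2 / (gamma * s) * _ = gamma * (2 * (Z + nu ^+ 2 * N) / s)); last first.
    by rewrite -ZE; field; rewrite !gt_eqF.
  rewrite (_ : 1 - gamma * d - _ = gamma * (s - d)); last by ring.
  rewrite ler_pM2l// ler_pdivrMr//.
  have : s / 60 * s >= d * s by rewrite ler_pM2r.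
  move: nuN LCH s20; rewrite !expr2 => *; lra.
(* Tracking row: [s ^ 2 * G = 4 * s ^ 2 + 36 * lam] must dominate [6 * lam] and fixed multiples of
   [Z] and [nu ^ 2 * N]; this is why [G] contains [lam / s ^ 2]. *)
- rewrite VE qE -lerBrDl.
  rewrite (_ : 2 / (gamma * s) * _ = gamma * L ^+ 2 * (2 * (Z + 3 * (lam + Z + nu ^+ 2
    * N)) / s)); last first.
    by rewrite -ZE; field; rewrite !gt_eqF.
  rewrite (_ : (1 - gamma * d) * _ - _ = gamma * L ^+ 2 * ((s - d) * G)); last by ring.
  rewrite ler_pM2l ?mulr_gt0// ler_pdivrMr//.
  have sG : s ^+ 2 * G = 4 * s ^+ 2 + 36 * lam by rewrite GE; field; rewrite gt_eqF.
  have : d * (G * s) <= s / 60 * (G * s) by rewrite ler_pM2r// mulr_gt0.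
  rewrite (_ : s / 60 * (G * s) = s ^+ 2 * G / 60); last by field.
  rewrite (_ : (s - d) * G * s = s ^+ 2 * G - d * (G * s)); last by ring.
  rewrite sG; move: nuN LCH s20 lam0; lra.
(* [gap] is the compression row for [Y] divided by [L ^ 2]; the row for [X] has the same right side
   and a smaller left side. *)
- rewrite VE qE [(1 - delta / 2)^-1 * _]mulrA dl [(delta / 2)^-1 * _]mulrA d2.
  rewrite -lerBrDl (_ : _ - _ * H = (delta / (2 - delta) - gamma * d) * H); last by ring.
  apply: le_trans gap.
  have : 6 / delta * (gamma ^+ 2 * (lam + Z + nu ^+ 2 * N)) <=
    6 / delta * gamma ^+ 2 * (lam * G + Z + 3 * (lam + Z + nu ^+ 2 * N)).
    have : 0 <= 6 / delta * gamma ^+ 2 by rewrite mulr_ge0 ?sqr_ge0 ?divr_ge0 ?(ltW d0).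
    move=> h6; rewrite [leLHS]mulrA; apply: (ler_wpM2l h6).
    have : 0 <= lam * G by rewrite mulr_ge0 ?(ltW G0).
    have : 0 <= nu ^+ 2 * N by rewrite mulr_ge0 ?sqr_ge0 ?(ltW N0) ?(ltW ks0).
    move: lam0; lra.
  exact: id.
- rewrite VE qE [(1 - delta / 2)^-1 * _]mulrA dl [(delta / 2)^-1 * _]mulrA d2.
  rewrite (_ : 6 / delta * _ = L ^+ 2 * (6 / delta * gamma ^+ 2 * (lam * G + Z + 3 *
    (lam + Z + nu ^+ 2 * N)))); last first.
    by rewrite -ZE; ring.
  rewrite -lerBrDl (_ : _ - _ * (L ^+ 2 * H) = L ^+ 2 * ((delta / (2 - delta) - gamma *
    d) * H)).
    by rewrite ler_pM2l.
  by ring.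
Qed.

End Arith.

(** * Propagation of the error bounds *)

Section IntLe.
Context {d} {R : realType} {T : measurableType d} (P : probability T R).

(** Measurability and sign travel with the bound, so that pathwise inequalities can be integrated
    term by term. *)
Definition int_le (F : T -> R) (b : R) :=
  [/\ measurable_fun setT F, forall w, 0 <= F w & (\int[P]_w (F w)%:E <= b%:E)%E].

Lemma int_leD F G a b : int_le F a -> int_le G b -> int_le (fun w => F w + G w) (a + b).
Proof.
move=> [mF F0 Fa] [mG G0 Gb]; split; first exact: measurable_funD.
  by move=> w; exact: addr_ge0.
under eq_integral do rewrite EFinD.
rewrite ge0_integralD//; last 4 first.
- by move=> w _; rewrite lee_fin.
- exact/measurable_EFinP.
- by move=> w _; rewrite lee_fin.
- exact/measurable_EFinP.
by rewrite EFinD leeD.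
Qed.

Lemma int_leZ F a k : 0 <= k -> int_le F a -> int_le (fun w => k * F w) (k * a).
Proof.
move=> k0 [mF F0 Fa]; split; first exact: measurable_funM.
  by move=> w; exact: mulr_ge0.
under eq_integral do rewrite EFinM.
rewrite ge0_integralZl//; last 2 first.
- exact/measurable_EFinP.
- by move=> w _; rewrite lee_fin.
by rewrite EFinM lee_wpmul2l// lee_fin.
Qed.

Lemma int_le_trans (F G : T -> R) (a b : R) : measurable_fun setT F ->
  (forall w, 0 <= F w) ->
  (forall w, F w <= G w) -> a <= b -> int_le G a -> int_le F b.
Proof.
move=> mF F0 FG ab [mG G0 Ga]; split => //.
apply: (@le_trans _ _ (\int[P]_w (G w)%:E)%E); last by apply: le_trans Ga _;
  rewrite lee_fin.
apply: ge0_le_integral => //.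
- by move=> w _; rewrite lee_fin.
- exact/measurable_EFinP.
- exact/measurable_EFinP.
- by move=> w _; rewrite lee_fin.
Qed.

Lemma int_le_cst (v : R) : 0 <= v -> int_le (fun=> v) v.
Proof.
move=> v0; split => //.
have := @expectation_cst _ _ _ P v; rewrite unlock /= => ->.
exact: lexx.
Qed.

End IntLe.

Lemma cvg_of_linear_rate {R : realType} (u : nat -> \bar R) (q : R) :
  0 < q -> q < 1 -> (forall k, 0 <= u k)%E -> linear_rate u q -> u @ \oo --> 0%E.
Proof.
move=> q0 q1 u0 [c uc].
apply: (@squeeze_cvge _ _ _ _ (fun=> 0%E) _ (fun k => (c * q ^+ k)%:E)).
- by apply: nearW => k; rewrite u0 uc.
- exact: cvg_cst.
- apply: cvg_EFin; first by apply: nearW.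
  by apply: cvg_geometric; rewrite ger0_norm// ltW.
Qed.

Lemma inner_le_frob {R : realType} p (u v : 'rV[R]_p) : inner u v <= frob u * frob v.
Proof.
apply: le_trans (ler_norm _) _.
rewrite -(@ler_pXn2r _ 2)// ?nnegrE ?mulr_ge0 ?frob_ge0// real_normK ?num_real//.
rewrite exprMn !frob2E !big_ord1; exact: cauchy_schwarz_sum.
Qed.

(** Both bounds are compared through Cauchy-Schwarz at [0] and a unit vector, which exists because
    [p] is positive. This yields [kappa >= 1]. *)
Lemma strong_convexity_le_lipschitz {R : realType} p mu L (f : 'rV[R]_p -> R) :
  (0 < p)%N -> strongly_convex_smooth mu L f -> mu <= L.
Proof.
case: p f => // p f _ [_ _ _ hmu hL].
pose e : 'rV[R]_p.+1 := delta_mx 0 0.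
have e1 : frob (e - 0) ^+ 2 = 1.
  rewrite subr0 frob2E big_ord1 (bigD1 ord0)//= big1 ?addr0 ?mxE ?expr1n//.
  by move=> j j0; rewrite mxE (negbTE j0) andbF expr0n.
have := hmu e 0; rewrite e1 mulr1 => /le_trans; apply.
apply: le_trans (inner_le_frob _ _ _) _.
apply: le_trans (ler_wpM2r (frob_ge0 _ _ _) (hL e 0)) _.
by rewrite -mulrA -expr2 e1 mulr1.
Qed.

(** * Induction on the iteration, in expectation *)

Section Rate.
Context {R : realType} {n p : nat} {dO dS : measure_display}
    {Omega : measurableType dO} {S : measurableType dS}
    (P : probability Omega R) (nu : probability S R)
    (C : S -> 'rV[R]_p -> 'rV[R]_p) (Cc delta r : R)
    (xi : nat * bool * 'I_n -> {RV P >-> S}).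
Hypotheses (n0 : (0 < n)%N) (hC : compressor nu C Cc delta r) (hxi : iid_seeds nu xi).
Variables (W : 'M[R]_n) (gamma : R).
Hypotheses (Wrow : W *m ones n = ones n) (Wcol : (ones n)^T *m W = (ones n)^T).
Hypothesis (rho1 : rho_w W < 1) (g0 : 0 < gamma) (g1 : gamma <= 1).
Variables (f : 'I_n -> 'rV[R]_p -> R) (mui : 'I_n -> R) (L : R) (xs : 'rV[R]_p).
Hypothesis L0 : 0 <= L.
Hypothesis fL : forall i x y, frob (grad (f i) x - grad (f i) y) <= L * frob (x - y).
Hypothesis fmu : forall i x y,
  mui i * frob (x - y) ^+ 2 <= inner (grad (f i) x - grad (f i) y) (x - y).
Hypothesis xsmin : \sum_i grad (f i) xs = 0.
Variables (eta : 'I_n -> R) (h : R) (X0 Hx0 Hy0 : 'M[R]_(n, p)).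
Hypothesis etah : forall i, 0 <= eta i <= h.
Let mu := n%:R^-1 * \sum_i mui i.
Let eb := n%:R^-1 * \sum_i eta i.
Let lam := spectral_norm (1%:M - W) ^+ 2.
Let s := 1 - rho_w W.
Hypotheses (mu0 : 0 < mu) (eb0 : 0 < eb).
Hypotheses (ebL : eb * L ^+ 2 <= mu / 2) (ebmu : eb * mu <= 2^-1).
Variables (q a c g kx ky : R).
Hypotheses (q0 : 0 < q) (a0 : 0 < a) (c0 : 0 < c) (gg0 : 0 < g) (kx0 : 0 < kx) (ky0 : 0
  < ky).
Let Ny := g + 2 * n%:R * L ^+ 2 * a + 2 * L ^+ 2 * c.
Let V := gamma ^+ 2 * lam * c + gamma ^+ 2 * lam * (Cc * kx) + h ^+ 2 * Ny.
Hypothesis row_a : (1 - eb * mu) * a + 4 / (eb * mu) *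
   (n%:R^-1 * (eb ^+ 2 * L ^+ 2 * c + h ^+ 2 * g)) <= q * a.
Hypothesis row_c : (1 - gamma * s) * c +
   2 / (gamma * s) * (gamma ^+ 2 * lam * (Cc * kx) + h ^+ 2 * Ny) <= q * c.
Hypothesis row_g : (1 - gamma * s) * g +
   2 / (gamma * s) * (gamma ^+ 2 * lam * (Cc * ky) + L ^+ 2 * (3 * V)) <= q * g.
Hypothesis row_kx : (1 - delta / 2)^-1 * ((1 - delta) * kx) +
   (delta / 2)^-1 * (3 * V) <= q * kx.
Hypothesis row_ky : (1 - delta / 2)^-1 * ((1 - delta) * ky) + (delta / 2)^-1 *
   (3 * (gamma ^+ 2 * lam * g + gamma ^+ 2 * lam * (Cc * ky) + L ^+ 2 * (3 * V))) <= q
     * ky.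

Let st k w := cgt W f eta gamma r^-1 r^-1 C X0 Hx0 Hy0 (fun i => xi i w) k.

Let avgY k w : avg (stY (st k w)) = avg (gradF f (stX (st k w))).
Proof. by elim: k => [|k IH] //; exact: tracking_invariant. Qed.

Let mst k := @measurable_state_cgt _ _ _ _ _ C (comp_meas hC) W f eta gamma r^-1 r^-1
   (fun=> L) fL _ _ P xi X0 Hx0 Hy0 k.

Let mX k : measurable_mx (fun w => stX (st k w)).
Proof. by case: (mst k) => m1 m2 m3 m4 i j;
  exact: (measurable_of_cylinders _ _ _ _ _ (m1 i j)). Qed.
Let mHx k : measurable_mx (fun w => stHx (st k w)).
Proof. by case: (mst k) => m1 m2 m3 m4 i j;
  exact: (measurable_of_cylinders _ _ _ _ _ (m2 i j)). Qed.
Let mY k : measurable_mx (fun w => stY (st k w)).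
Proof. by case: (mst k) => m1 m2 m3 m4 i j;
  exact: (measurable_of_cylinders _ _ _ _ _ (m3 i j)). Qed.
Let mHy k : measurable_mx (fun w => stHy (st k w)).
Proof. by case: (mst k) => m1 m2 m3 m4 i j;
  exact: (measurable_of_cylinders _ _ _ _ _ (m4 i j)). Qed.

Lemma measurable_mx_avg {d} {T : measurableType d} (X : T -> 'M[R]_(n, p)) :
  measurable_mx X -> measurable_mx (fun w => avg (X w)).
Proof. by move=> mX'; apply: measurable_mxZ; exact: measurable_mx_mul. Qed.

Lemma measurable_mx_dev {d} {T : measurableType d} (X : T -> 'M[R]_(n, p)) :
  measurable_mx X -> measurable_mx (fun w => dev (X w)).
Proof. by move=> mX'; apply: measurable_mxB => //; apply: measurable_mx_mul;
  exact: measurable_mx_avg. Qed.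

Let Ea k w := frob (avg (stX (st k w)) - xs) ^+ 2.
Let Ec k w := frob (dev (stX (st k w))) ^+ 2.
Let Eg k w := frob (dev (stY (st k w))) ^+ 2.
Let Ekx k w := frob (stX (st k w) - stHx (st k w)) ^+ 2.
Let Eky k w := frob (stY (st k w) - stHy (st k w)) ^+ 2.

Let mEa k : measurable_fun setT (Ea k).
Proof. by apply: measurable_frob2; apply: measurable_mxB;
  [exact: measurable_mx_avg|exact: measurable_mx_cst]. Qed.
Let mEc k : measurable_fun setT (Ec k).
Proof. by apply: measurable_frob2; exact: measurable_mx_dev. Qed.
Let mEg k : measurable_fun setT (Eg k).
Proof. by apply: measurable_frob2; exact: measurable_mx_dev. Qed.
Let mEkx k : measurable_fun setT (Ekx k).
Proof. by apply: measurable_frob2; exact: measurable_mxB. Qed.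
Let mEky k : measurable_fun setT (Eky k).
Proof. by apply: measurable_frob2; exact: measurable_mxB. Qed.

Let resid k (b : bool) al (Z : Omega -> 'M[R]_(n, p)) w :=
  frob (al *: \matrix_i C (xi (k, b, i) w) (row i (Z w)) - Z w) ^+ 2.

Let int_le_resid k b al cc B (Z : Omega -> 'M[R]_(n, p)) :
  (forall x, (\int[nu]_s0 (frob (al *: C s0 x - x) ^+ 2)%:E <= (cc * frob x ^+
    2)%:E)%E) ->
  0 <= cc ->
  @measurable_mx _ _ (g_sigma_algebraType (cylinders xi (past k))) _ _ Z ->
  int_le P (fun w => frob (Z w) ^+ 2) B -> int_le P (resid k b al Z) (cc * B).
Proof.
move=> hc cc0 mZ [m1 m2 m3].
have mZO : measurable_mx Z by move=> i j;
  exact: (measurable_of_cylinders _ _ _ _ _ (mZ i j)).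
split; last first.
- apply: le_trans (expectation_compress_le C (comp_meas hC) P nu xi hxi k b Z al cc hc
    cc0 mZ) _.
  by rewrite EFinM lee_wpmul2l// lee_fin.
- by move=> w; exact: sqr_ge0.
- apply: measurable_frob2; apply: measurable_mxB => //; apply: measurable_mxZ.
  exact: (measurable_mx_compress_rows C (comp_meas hC) (fun i w => xi (k, b, i) w)).
Qed.

Lemma errors_linear_rate : exists K, 0 <= K /\ forall k,
  [/\ int_le P (Ea k) (K * q ^+ k * a), int_le P (Ec k) (K * q ^+ k * c),
      int_le P (Eg k) (K * q ^+ k * g), int_le P (Ekx k) (K * q ^+ k * kx) &
      int_le P (Eky k) (K * q ^+ k * ky)].
Proof.
have [Cc0 d0 d1 r0 mC herr hcontr] := hC.
have h1C x : (\int[nu]_s0 (frob (1 *: C s0 x - x) ^+ 2)%:E <= (Cc * frob x ^+ 2)%:E)%E.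
  by have := herr x; rewrite unlock; under eq_integral do rewrite -[C _ _]scale1r.
have hrC x : (\int[nu]_s0 (frob (r^-1 *: C s0 x - x) ^+ 2)%:E <= ((1 - delta) * frob x
  ^+ 2)%:E)%E.
  by have := hcontr x; rewrite unlock.
have d1' : 0 <= 1 - delta by rewrite subr_ge0.
have [q0' a0' c0'] := And3 (ltW q0) (ltW a0) (ltW c0).
have [gg0' kx0' ky0'] := And3 (ltW gg0) (ltW kx0) (ltW ky0).
(* The initial state is deterministic, so its errors can be read off at any outcome; [K] sums their
   ratios to the weights and thus dominates each ratio. *)
pose w0 : Omega := point.
pose v E : R := E 0%N w0 : R.
pose K := v Ea / a + v Ec / c + v Eg / g + v Ekx / kx + v Eky / ky.
have va : 0 <= v Ea / a by rewrite divr_ge0 ?sqr_ge0.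
have vc : 0 <= v Ec / c by rewrite divr_ge0 ?sqr_ge0.
have vg : 0 <= v Eg / g by rewrite divr_ge0 ?sqr_ge0.
have vkx : 0 <= v Ekx / kx by rewrite divr_ge0 ?sqr_ge0.
have vky : 0 <= v Eky / ky by rewrite divr_ge0 ?sqr_ge0.
have K0 : 0 <= K by rewrite !addr_ge0.
exists K; split => //; elim => [|k [IHa IHc IHg IHx IHy]].
  rewrite expr0 mulr1.
  split.
  - apply: (int_le_trans P _ (fun=> v Ea) (v Ea)) => //.
    + by move=> w; exact: sqr_ge0.
    + by rewrite -ler_pdivrMr// /K; lra.
    + by apply: int_le_cst; exact: sqr_ge0.
  - apply: (int_le_trans P _ (fun=> v Ec) (v Ec)) => //.
    + by move=> w; exact: sqr_ge0.
    + by rewrite -ler_pdivrMr// /K; lra.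
    + by apply: int_le_cst; exact: sqr_ge0.
  - apply: (int_le_trans P _ (fun=> v Eg) (v Eg)) => //.
    + by move=> w; exact: sqr_ge0.
    + by rewrite -ler_pdivrMr// /K; lra.
    + by apply: int_le_cst; exact: sqr_ge0.
  - apply: (int_le_trans P _ (fun=> v Ekx) (v Ekx)) => //.
    + by move=> w; exact: sqr_ge0.
    + by rewrite -ler_pdivrMr// /K; lra.
    + by apply: int_le_cst; exact: sqr_ge0.
  - apply: (int_le_trans P _ (fun=> v Eky) (v Eky)) => //.
    + by move=> w; exact: sqr_ge0.
    + by rewrite -ler_pdivrMr// /K; lra.
    + by apply: int_le_cst; exact: sqr_ge0.
have [B BE] : exists B, K * q ^+ k = B by exists (K * q ^+ k).
have B0 : 0 <= B by rewrite -BE mulr_ge0// exprn_ge0.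
have BS e : K * q ^+ k.+1 * e = B * (q * e) by rewrite exprSr -BE; ring.
rewrite !BS; rewrite !BE in IHa IHc IHg IHx IHy.
case: (mst k) => m1 m2 m3 m4.
pose Zx w := stX (st k w) - stHx (st k w).
pose Zy w := stY (st k w) - stHy (st k w).
have mZx : @measurable_mx _ _ (g_sigma_algebraType (cylinders xi (past k))) _ _ Zx
  by exact: measurable_mxB.
have mZy : @measurable_mx _ _ (g_sigma_algebraType (cylinders xi (past k))) _ _ Zy
  by exact: measurable_mxB.
have Iex := int_le_resid k false _ _ _ _ h1C Cc0 mZx IHx.
have Iux := int_le_resid k false _ _ _ _ hrC d1' mZx IHx.
have Iey := int_le_resid k true _ _ _ _ h1C Cc0 mZy IHy.
have Iuy := int_le_resid k true _ _ _ _ hrC d1' mZy IHy.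
have lam0 : 0 <= lam by exact: sqr_ge0.
have nn0 : 0 <= n%:R :> R by [].
have INy : int_le P (fun w => Eg k w + 2 * n%:R * L ^+ 2 * Ea k w + 2 * L ^+ 2 * Ec k w)
    (B * Ny).
  rewrite (_ : B * Ny = B * g + 2 * n%:R * L ^+ 2 * (B * a) + 2 * L ^+ 2 * (B * c));
    last first.
    by rewrite /Ny; ring.
  by apply: int_leD; [apply: int_leD => //|]; apply: int_leZ => //;
    rewrite !mulr_ge0// sqr_ge0.
have gl0 : 0 <= gamma ^+ 2 * lam by rewrite mulr_ge0// sqr_ge0.
have IV : int_le P (fun w => gamma ^+ 2 * lam * Ec k w
    + gamma ^+ 2 * lam * resid k false 1 Zx w
    + h ^+ 2 * (Eg k w + 2 * n%:R * L ^+ 2 * Ea k w + 2 * L ^+ 2 * Ec k w)) (B * V).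
  rewrite (_ : B * V = gamma ^+ 2 * lam * (B * c) + gamma ^+ 2 * lam * (Cc * (B * kx))
    + h ^+ 2 * (B * Ny)); last first.
    by rewrite /V; ring.
  by apply: int_leD; [apply: int_leD|]; apply: int_leZ => //; exact: sqr_ge0.
have s0 : 0 < s by rewrite subr_gt0.
have gs0 : 0 <= 2 / (gamma * s) by rewrite divr_ge0// mulr_ge0// ltW.
have gs1 : 0 <= 1 - gamma * s.
  rewrite subr_ge0 mulr_ile1 ?(ltW g0) ?(ltW s0)//.
  by rewrite lerBlDr lerDl; exact: spectral_norm_ge0.
split.
- apply: (int_le_trans P _ _ _ _ (mEa k.+1)).
  + by move=> w; exact: sqr_ge0.
  + move=> w; apply: (@optimality_row _ _ _ n0 W gamma Wcol f mui L xs L0 fL fmu xsmin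
      eta h r^-1 etah _ _ (st k w) (avgY k w)) => //.
  + exact: ler_wpM2l row_a.
  + rewrite (_ : B * _ = (1 - eb * mu) * (B * a) + 4 / (eb * mu) * (n%:R^-1 * (eb ^+ 2
      * L ^+ 2 * (B * c) + h ^+ 2 * (B * g)))); last by ring.
    apply: int_leD; first by apply: int_leZ => //;
      rewrite subr_ge0 (le_trans ebmu)// invf_le1// ler1n.
    apply: int_leZ; first by rewrite divr_ge0// mulr_ge0// ltW.
    apply: int_leZ; first by rewrite invr_ge0.
    have eL0 : 0 <= eb ^+ 2 * L ^+ 2 by apply: mulr_ge0; exact: sqr_ge0.
    by apply: int_leD; apply: int_leZ => //; exact: sqr_ge0.
- apply: (int_le_trans P _ _ _ _ (mEc k.+1)).
  + by move=> w; exact: sqr_ge0.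
  + move=> w; apply: (@consensus_row _ _ _ n0 W gamma Wrow Wcol rho1 g0 g1 f L xs L0 fL
      xsmin eta h r^-1 etah _ _ (st k w) (avgY k w)).
  + exact: ler_wpM2l row_c.
  + rewrite (_ : B * _ = (1 - gamma * s) * (B * c) + 2 / (gamma * s) * (gamma ^+ 2 *
      lam * (Cc * (B * kx)) + h ^+ 2 * (B * Ny))); last by ring.
    apply: int_leD; first exact: int_leZ.
    apply: int_leZ => //.
    by apply: int_leD; apply: int_leZ => //; exact: sqr_ge0.
- apply: (int_le_trans P _ _ _ _ (mEg k.+1)).
  + by move=> w; exact: sqr_ge0.
  + move=> w; apply: (@tracking_row _ _ _ n0 W gamma Wrow Wcol rho1 g0 g1 f L xs L0 fL
      xsmin eta h r^-1 etah _ _ (st k w) (avgY k w)).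
  + exact: ler_wpM2l row_g.
  + rewrite (_ : B * _ = (1 - gamma * s) * (B * g) + 2 / (gamma * s) * (gamma ^+ 2 *
      lam * (Cc * (B * ky)) + L ^+ 2 * (3 * (B * V)))); last by ring.
    apply: int_leD; first exact: int_leZ.
    apply: int_leZ => //.
    by apply: int_leD; apply: int_leZ => //; [exact: sqr_ge0|exact: int_leZ].
- apply: (int_le_trans P _ _ _ _ (mEkx k.+1)).
  + by move=> w; exact: sqr_ge0.
  + move=> w; apply: (@compression_x_row _ _ _ n0 W gamma Wrow f L xs L0 fL xsmin eta h
      delta r^-1 etah d0 d1 _ _ (st k w) (avgY k w)).
  + exact: ler_wpM2l row_kx.
  + rewrite (_ : B * _ = (1 - delta / 2)^-1 * ((1 - delta) * (B * kx)) + (delta / 2)^-1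
      * (3 * (B * V))); last by ring.
    apply: int_leD; apply: int_leZ => //; first by rewrite invr_ge0; lra.
      by rewrite invr_ge0 divr_ge0// ltW.
    exact: int_leZ.
- apply: (int_le_trans P _ _ _ _ (mEky k.+1)).
  + by move=> w; exact: sqr_ge0.
  + move=> w; apply: (@compression_y_row _ _ _ n0 W gamma Wrow f L xs L0 fL xsmin eta h
      delta r^-1 etah d0 d1 _ _ (st k w) (avgY k w)).
  + exact: ler_wpM2l row_ky.
  + rewrite (_ : B * _ = (1 - delta / 2)^-1 * ((1 - delta) * (B * ky)) + (delta / 2)^-1
      * (3 * (gamma ^+ 2 * lam * (B * g) + gamma ^+ 2 * lam * (Cc * (B * ky)) + L ^+ 2
        * (3 * (B * V))))); last by ring.
    apply: int_leD; apply: int_leZ => //; first by rewrite invr_ge0; lra.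
      by rewrite invr_ge0 divr_ge0// ltW.
    apply: int_leZ => //; apply: int_leD; [apply: int_leD|]; apply: int_leZ => //.
      exact: sqr_ge0.
    exact: int_leZ.
Qed.

End Rate.

Theorem theorem1 (R : realType) (n p : nat) (hn : (0 < n)%N) (hp : (0 < p)%N)
    (e : rel 'I_n) (W : 'M[R]_n) (hW : network e W)
    (f : 'I_n -> 'rV[R]_p -> R) (mui Li : 'I_n -> R)
    (hf : forall i, strongly_convex_smooth (mui i) (Li i) (f i))
    (xstar : 'rV[R]_p)
    (hxstar : unique (fun x => forall y, avg_cost f x <= avg_cost f y) xstar)
    (dO dS : measure_display)
    (Omega : measurableType dO) (S : measurableType dS)
    (P : probability Omega R) (nu : probability S R)
    (C : S -> 'rV[R]_p -> 'rV[R]_p) (Cc delta r : R)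
    (hC : compressor nu C Cc delta r)
    (xi : nat * bool * 'I_n -> {RV P >-> S}) (hxi : iid_seeds nu xi)
    (eta : 'I_n -> R) (heta : forall i, 0 < eta i)
    (gamma alphax alphay : R) (X0 Hx0 Hy0 : 'M[R]_(n, p)) (M : R) :
  let mu := n%:R^-1 * \sum_(i < n) mui i in
  let L := \big[Num.max/0]_(i < n) Li i in
  let kappa := L / mu in
  let s := 1 - rho_w W in
  let lambda := spectral_norm (1%:M - W) ^+ 2 in
  let etabar := n%:R^-1 * \sum_(i < n) eta i in
  let etahat := \big[Num.max/0]_(i < n) eta i in
  let m :=
    6 / delta *
      ((72 * kappa ^+ 2 / M ^+ 2 + lambda + 3) *
         (432 * Cc * lambda ^+ 2 / s ^+ 4 + 48 * Cc * lambda / s ^+ 2)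
       + (3 * lambda + 6) * (12 * Cc * lambda / s ^+ 2)
       + 4 * Cc * lambda)
    + M / (2 * kappa) in
  let X (k : nat) (w : Omega) : 'M[R]_(n, p) :=
    stX (cgt W f eta gamma alphax alphay C X0 Hx0 Hy0 (fun i => xi i w) k) in
  let Omega_o (k : nat) : \bar R :=
    ('E_P[fun w => (frob (avg (X k w) - xstar) ^+ 2)%R])%E in
  let Omega_c (k : nat) : \bar R :=
    ('E_P[fun w => (frob (X k w - ones n *m avg (X k w)) ^+ 2)%R])%E in
  let q := 1 - M * etahat * mu / 2 in
  0 < M -> M * etahat <= etabar ->
  alphax = r^-1 -> alphay = r^-1 ->
  0 < gamma -> gamma <= Num.min 1 (delta / (m * (2 - delta))) ->
  etahat <= s ^+ 2
      / Num.sqrt (12 * ((24 * kappa ^+ 2 / M ^+ 2 + 1) * (4 * s ^+ 2 + 36 * lambda)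
                        + 2 * s ^+ 2))
      * (gamma / L) ->
  [/\ Omega_o @ \oo --> 0%E, linear_rate Omega_o q,
      Omega_c @ \oo --> 0%E & linear_rate Omega_c q].
Proof.
move=> mu L kappa s lambda etabar etahat m X Omega_o Omega_c q M0 Mh ax ay g0 gle etale.
have [_ _ _ _ Wrow Wcol _ rho1] := hW.
have [Cc0 d0 d1 r0 _ _ _] := hC.
have nR : 0 < n%:R :> R by rewrite ltr0n.
have i0 : 'I_n by exact: Ordinal hn.
have avg_gt0 (F : 'I_n -> R) : (forall i, 0 < F i) -> 0 < n%:R^-1 * \sum_i F i.
  move=> F0; rewrite mulr_gt0 ?invr_gt0//.
  by rewrite (bigD1 i0)//= ltr_pwDl// sumr_ge0// => i _; exact: ltW.
have avg_le (F : 'I_n -> R) B : (forall i, F i <= B) -> n%:R^-1 * \sum_i F i <= B.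
  move=> FB; rewrite ler_pdivrMl// mulr_natl -[X in _ *+ X]card_ord -sumr_const.
  exact: ler_sum.
have mu0 : 0 < mu by apply: avg_gt0 => i; have [] := hf i.
have etabar0 : 0 < etabar by exact: avg_gt0.
have etah i : 0 <= eta i <= etahat by rewrite ltW//= le_bigmax.
have muL : mu <= L.
  apply: avg_le => i; apply: le_trans (le_bigmax _ _ i).
  exact: strong_convexity_le_lipschitz hp (hf i).
have L0 : 0 <= L by rewrite ltW// (lt_le_trans mu0).
have fL i x y : frob (grad (f i) x - grad (f i) y) <= L * frob (x - y).
  have [_ _ _ _ hL] := hf i; apply: le_trans (hL x y) _.
  by rewrite ler_wpM2r ?frob_ge0// le_bigmax.
have fmu i x y : mui i * frob (x - y) ^+ 2 <= inner (grad (f i) x - grad (f i) y) (x - y).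
  by have [_ _ _ hmu _] := hf i.
have xsmin : \sum_i grad (f i) xstar = 0.
  have [xmin _] := hxstar; apply: avg_grad_eq0 => // i y.
  by have [_ _ hd _ _] := hf i.
have s0 : 0 < s by rewrite subr_gt0.
have s1 : s <= 1 by rewrite lerBlDr lerDl; exact: spectral_norm_ge0.
have [g1 gm] : gamma <= 1 /\ gamma <= delta / (m * (2 - delta)).
  by move: gle; rewrite le_min => /andP[].
have etahat0 : 0 < etahat by apply: lt_le_trans (le_bigmax _ _ i0).
have ebh : etabar <= etahat by apply: avg_le => i; exact: le_bigmax.
have lam0 : 0 <= lambda by exact: sqr_ge0.
(* The four placeholders are [ks], [G], [N] and [nu]; the last four [erefl] determine them. *)
have ebL := step_size_small mu L lambda s gamma etahat etabar M kappa _
  _ _ _ mu0 muL lam0 s0 s1 g0 g1 etahat0 M0 Mh ebh erefl etale erefl erefl erefl erefl.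
have ebmu := step_size_small_mu mu L lambda s gamma etahat etabar M kappa _
  _ _ _ mu0 muL lam0 s0 s1 g0 g1 etahat0 M0 Mh ebh erefl etale erefl erefl erefl erefl.
have [q0 q1] := rate_bounds mu L lambda s gamma etahat etabar M kappa _
  _ _ _ mu0 muL lam0 s0 s1 g0 g1 etahat0 M0 Mh ebh erefl etale erefl erefl erefl erefl.
have [a [c [g [kx [ky [[a0 c0 gg0 kx0 ky0] [ra rc rg rkx rky]]]]]]] :=
  error_weights mu L lambda s gamma etahat etabar M Cc delta n%:R kappa m _
  _ _ _ mu0 muL lam0 s0 s1 g0 g1 etahat0 M0 Mh ebh Cc0 d0 d1 nR
  erefl erefl gm etale erefl erefl erefl erefl.
have [K [K0 HK]] := errors_linear_rate P nu C Cc delta r xi hn hC hxi W gamma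
  Wrow Wcol rho1 g0 g1 f mui L xstar L0 fL fmu xsmin eta etahat X0 Hx0 Hy0 etah
  mu0 etabar0 ebL ebmu q a c g kx ky q0 a0 c0 gg0 kx0 ky0 ra rc rg rkx rky.
have ro : linear_rate Omega_o q.
  exists (K * a) => k; rewrite /Omega_o /X ax ay unlock mulrAC.
  by have [[_ _ h] _ _ _ _] := HK k.
have rcons : linear_rate Omega_c q.
  exists (K * c) => k; rewrite /Omega_c /X ax ay unlock mulrAC.
  by have [_ [_ _ h] _ _ _] := HK k.
split => //.
- apply: (cvg_of_linear_rate _ q q0 q1 _ ro) => k; apply: expectation_ge0 => w;
    exact: sqr_ge0.
- apply: (cvg_of_linear_rate _ q q0 q1 _ rcons) => k; apply: expectation_ge0 => w;
    exact: sqr_ge0.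
Qed.
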